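(* Let $U\subset P(m)$ be a shifted order ideal and $t\ge 0$ an integer. The graded Betti numbers of the Stanley-Reisner ideal of the squeezed complex $\Delta_t(U)$ are $$\beta_{i,i+j}(I_{\Delta_t(U)})=\sum_{u\in G(I(U)),\ \deg u=j}\binom{\max(u)-1}{i},$$ where $\max(u)$ is the largest index of a variable dividing the monomial $u$.
   Context: Notation. $\mathbb{K}$ is a field, $m\ge 1$, $P(n)=\mathbb{K}[x_1,\ldots,x_n]$; $[n]=\{1,\ldots,n\}$ and $[a,b]=\{c\in\mathbb{N} : a\le c\le b\}$ (empty if $a>b$). For a graded $P(n)$-module $M$, $\beta_{i,j}(M)=\dim_{\mathbb{K}}[\operatorname{Tor}_i^{P(n)}(M,\mathbb{K})]_j$. For a monomial ideal $I$, $G(I)$ is its unique minimal set of monomial generators. Order ideals. A monomial order ideal of $P(m)$ is a finite set $U$ of monomials of $P(m)$ closed under taking divisors; it is always assumed that $1,x_1,\ldots,x_m\in U$. $U$ is shifted if $x_iu\in U$ ($u$ a monomial) and $i<j\le m$ imply $x_ju\in U$. $d_{\max}(U)$ is the maximal degree of a monomial in $U$. $I(U)$ is the monomial ideal of $P(m)$ generated by all monomials of $P(m)$ not in $U$. Squeezed complexes. Put $d=d_{\max}(U)$ and let $t\ge 0$ be an integer. For $u=x_{i_1}\cdots x_{i_s}\in U$ with $i_1\le\cdots\le i_s$ set $$F_t(u)=\bigcup_{\ell=1}^s\{i_\ell+2(\ell-1),\,i_\ell+2\ell-1\}\cup[m+2s+1,\,m+t+d]\quad\text{if } s\le t,$$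 $$F_t(u)=\bigcup_{\ell=1}^t\{i_\ell+2(\ell-1),\,i_\ell+2\ell-1\}\cup\bigcup_{\ell=t+1}^s\{i_\ell+\ell+t-1\}\cup[m+t+s+1,\,m+t+d]\quad\text{if } s\ge t.$$ Each $F_t(u)$ is a $(d+t)$-subset of $[m+t+d]$. $\Delta_t(U)$ is the pure $(d+t-1)$-dimensional simplicial complex on vertex set $[m+t+d]$ whose facets are the sets $F_t(u)$, $u\in U$. Its Stanley-Reisner ideal $I_{\Delta_t(U)}\subset P(m+t+d)$ is generated by the squarefree monomials $\prod_{i\in F}x_i$ with $F\subseteq[m+t+d]$, $F\notin\Delta_t(U)$; its Betti numbers are taken over $P(m+t+d)$. *)

(* Defs.v *)
From mathcomp Require Import all_boot all_order all_algebra finmap.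
From mathcomp Require Import mpoly.

Set Implicit Arguments.
Unset Strict Implicit.
Unset Printing Implicit Defensive.

Import GRing.Theory.
Local Open Scope fset_scope.
Local Open Scope ring_scope.

Definition ideal_gen (R : comNzRingType) (S : R -> Prop) (p : R) : Prop :=
  exists s : seq (R * R),
    (forall c, c \in s -> S c.2) /\ p = \sum_(c <- s) c.1 * c.2.

Definition monomial_ideal (K : fieldType) (n : nat) (S : 'X_{1..n} -> Prop) :
    {mpoly K[n]} -> Prop :=
  ideal_gen (fun p => exists2 u, S u & p = 'X_[u]).

Definition generated_by_monomials (K : fieldType) (n : nat)
    (I : {mpoly K[n]} -> Prop) (G : {fset 'X_{1..n}}) : Prop :=
  forall p, I p <-> monomial_ideal (fun u => u \in G) p.

Definition minimal_monomial_generators (K : fieldType) (n : nat)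
    (I : {mpoly K[n]} -> Prop) (G : {fset 'X_{1..n}}) : Prop :=
  generated_by_monomials I G /\
  forall H : {fset 'X_{1..n}}, H `<` G -> ~ generated_by_monomials I H.

(* The largest index, counted from 1, of a variable dividing [u]; it is 0 for
   [u = 1]. *)
Definition max_index (n : nat) (u : 'X_{1..n}) : nat :=
  \max_(i < n | (0 < u i)%N) i.+1.

(* A resolution ... -> F_1 -> F_0 -> I -> 0 of an ideal [I] by graded free
   modules of finite rank.  F_i is the module of row vectors of length
   [rk i], its k-th basis vector having degree [sh i k], so that F_i is the
   direct sum of the P(- sh i k); maps act on row vectors from the right. *)
Record graded_free_resolution (K : fieldType) (n : nat)
    (I : {mpoly K[n]} -> Prop) := GradedFreeResolution {
  rk : nat -> nat;
  sh : forall i, 'I_(rk i) -> int;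
  dif : forall i, 'M[{mpoly K[n]}]_(rk i.+1, rk i);
  aug : 'cV[{mpoly K[n]}]_(rk 0);
  dif_homog : forall i k l u, u \in msupp (dif i k l) ->
    (mdeg u)%:Z + sh l = sh k;
  aug_homog : forall k u, u \in msupp (aug k 0) -> (mdeg u)%:Z = sh k;
  aug_onto : forall p, I p <-> exists v : 'rV_(rk 0), p = (v *m aug) 0 0;
  exact_aug : forall v : 'rV_(rk 0),
    v *m aug = 0 <-> exists w, v = w *m dif 0;
  exact_dif : forall i (v : 'rV_(rk i.+1)),
    v *m dif i = 0 <-> exists w, v = w *m dif i.+1
}.

Section Tor.

Variables (K : fieldType) (n : nat) (I : {mpoly K[n]} -> Prop).
Variable F : graded_free_resolution I.

(* As K = P / (x_1, ..., x_n), tensoring F_i with K gives K^(rk i), and a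
   matrix of polynomials becomes the matrix of its constant terms. *)
Definition tensor_dif (i : nat) : 'M[K]_(rk F i.+1, rk F i) :=
  map_mx (mcoeff 0%MM) (dif F i).

(* The row space is the degree [j] part of the tensor product of F_i and K. *)
Definition tensor_piece (i : nat) (j : int) : 'M[K]_(rk F i) :=
  diag_mx (\row_k (sh k == j)%:R).

Definition tor_cycles (i : nat) (j : int) : 'M[K]_(rk F i) :=
  match i return 'M[K]_(rk F i) with
  | 0 => tensor_piece 0 j
  | i'.+1 => (tensor_piece i'.+1 j :&: kermx (tensor_dif i'))%MS
  end.

Definition tor_boundaries (i : nat) (j : int) : 'M[K]_(rk F i.+1, rk F i) :=
  tensor_piece i.+1 j *m tensor_dif i.

(* The boundaries are contained in the cycles, so the subtraction is exact. *)
Definition tor_dim (i : nat) (j : int) : nat :=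
  (\rank (tor_cycles i j) - \rank (tor_boundaries i j))%N.

End Tor.

(* [b] is the dimension of the degree [j] part of Tor_i(I, K): graded free
   resolutions of [I] exist, and each of them computes [b]. *)
Definition graded_betti_number (K : fieldType) (n : nat)
    (I : {mpoly K[n]} -> Prop) (i : nat) (j : int) (b : nat) : Prop :=
  inhabited (graded_free_resolution I) /\
  forall F : graded_free_resolution I, tor_dim F i j = b.

Definition order_ideal (m : nat) (U : {fset 'X_{1..m}}) : Prop :=
  [/\ forall u v : 'X_{1..m}, u \in U -> (v <= u)%MM -> v \in U,
      0%MM \in U
    & forall i : 'I_m, U_(i)%MM \in U].

Definition shifted (m : nat) (U : {fset 'X_{1..m}}) : Prop :=
  forall (i j : 'I_m) (u : 'X_{1..m}),
    (i < j)%N -> (U_(i) + u)%MM \in U -> (U_(j) + u)%MM \in U.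

Definition dmax (m : nat) (U : {fset 'X_{1..m}}) : nat :=
  \max_(u <- U) mdeg u.

Definition ideal_of (K : fieldType) (m : nat) (U : {fset 'X_{1..m}}) :
    {mpoly K[m]} -> Prop :=
  monomial_ideal (fun u => u \notin U).
Arguments ideal_of K {m} U.

(* For u = x_(i_1) ... x_(i_s) with i_1 <= ... <= i_s, the sequence of the
   indices i_1, ..., i_s, where variables are counted from 1. *)
Definition indices (m : nat) (u : 'X_{1..m}) : seq nat :=
  flatten [seq nseq (u i) (val i).+1 | i <- enum 'I_m].

(* Membership of [c] in F_t(u), with vertices counted from 1. *)
Definition in_facet (m d t : nat) (u : 'X_{1..m}) (c : nat) : bool :=
  let s := mdeg u in
  let idx l := nth 0%N (indices u) l.-1 in
  let pair l := (c == idx l + 2 * (l - 1))%N || (c == idx l + 2 * l - 1)%N in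
  if (s <= t)%N then
    has pair (index_iota 1 s.+1) || (m + 2 * s + 1 <= c <= m + t + d)%N
  else
    [|| has pair (index_iota 1 t.+1),
        has (fun l => c == idx l + l + t - 1)%N (index_iota t.+1 s.+1)
      | (m + t + s + 1 <= c <= m + t + d)%N].

(* The vertex [c] of the 1-based vertex set is the ordinal [c - 1]. *)
Definition facet (m : nat) (U : {fset 'X_{1..m}}) (t : nat) (u : 'X_{1..m}) :
    {set 'I_(m + t + dmax U)} :=
  [set c : 'I_(m + t + dmax U) | in_facet (dmax U) t u c.+1].

Definition squeezed_complex (m : nat) (U : {fset 'X_{1..m}}) (t : nat) :
    {set {set 'I_(m + t + dmax U)}} :=
  [set A : {set 'I_(m + t + dmax U)} | has (fun u => A \subset facet U t u) U].

Definition stanley_reisner (K : fieldType) (n : nat) (D : {set {set 'I_n}}) :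
    {mpoly K[n]} -> Prop :=
  ideal_gen (fun p => exists2 A : {set 'I_n}, A \notin D & p = \prod_(i in A) 'X_i).
Arguments stanley_reisner K {n} D.

(* The minimal monomial generators of I(U) form a finite set, so quantifying
   over [minimal_monomial_generators (ideal_of K U) G] is not vacuous. *)
Section MinimalGenerators.

Variables (K : fieldType) (m : nat).
Implicit Types (u v w : 'X_{1..m}).

Lemma monomial_ideal_msupp (S : 'X_{1..m} -> Prop) (p : {mpoly K[m]}) u :
  monomial_ideal S p -> u \in msupp p -> exists2 v, S v & (v <= u)%MM.
Proof.
case=> s [Ss ->{p}]; elim: s Ss => [|c s IHs] Ss.
  by rewrite big_nil msupp0 in_nil.
rewrite big_cons => /msuppD_le; rewrite mem_cat => /orP[|]; last first.
  by apply: IHs => c' c's; apply: Ss; rewrite in_cons c's orbT.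
have [v Sv ->] := Ss c (mem_head _ _).
move=> /msuppM_le /allpairsP[[a b] /= [_]].
rewrite msuppX mem_seq1 => /eqP-> ->.
by exists v => //; rewrite lem_addl.
Qed.

Lemma monomial_idealX (S : 'X_{1..m} -> Prop) u v :
  S v -> (v <= u)%MM -> monomial_ideal S ('X_[u] : {mpoly K[m]}).
Proof.
move=> Sv le_vu; exists [:: ('X_[u - v], 'X_[v])]; split.
  by move=> c; rewrite mem_seq1 => /eqP->; exists v.
by rewrite big_seq1 /= -mpolyXD submK.
Qed.

Lemma monomial_ideal_trans (S T : 'X_{1..m} -> Prop) (p : {mpoly K[m]}) :
  (forall u, S u -> exists2 v, T v & (v <= u)%MM) ->
  monomial_ideal S p -> monomial_ideal T p.
Proof.
move=> ST [s [Ss ->{p}]]; elim: s Ss => [|c s IHs] Ss.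
  by exists [::]; rewrite !big_nil.
have [|r [Tr def_r]] := IHs.
  by move=> c' c's; apply: Ss; rewrite in_cons c's orbT.
have [u /ST[v Tv le_vu] def_c] := Ss c (mem_head _ _).
exists ((c.1 * 'X_[u - v], 'X_[v]) :: r); split.
  move=> c'; rewrite in_cons => /orP[/eqP->|/Tr //].
  by exists v.
by rewrite !big_cons /= -def_r -mulrA -mpolyXD submK // def_c.
Qed.

Lemma minimal_monomial_generators_ideal_of (U : {fset 'X_{1..m}}) :
  order_ideal U ->
  exists G, minimal_monomial_generators (ideal_of K U) G.
Proof.
case=> divU U1 _.
pose mg u := (u \notin U) &&
  [forall i : 'I_m, (U_(i) <= u)%MM ==> ((u - U_(i))%MM \in U)].
pose G := [fset u in
  [seq (v + U_(i))%MM | v <- enum_fset U, i <- enum 'I_m] | mg u].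
have inG u : (u \in G) = mg u.
  rewrite !inE /= andb_idl // => /andP[uU /forallP mu].
  have [i lei] : exists i, (U_(i) <= u)%MM.
    have : u != 0%MM by apply: contraNneq uU => ->.
    rewrite -mdeg_eq0 mdegE sum_nat_eq0 negb_forall => /existsP[i ui].
    by exists i; rewrite lep1mP -lt0n lt0n.
  apply/allpairsP; exists ((u - U_(i))%MM, i).
  by rewrite mem_enum /= submK //; split=> //; have := mu i; rewrite lei.
have belowG k u : mdeg u = k -> u \notin U -> exists2 v, v \in G & (v <= u)%MM.
  elim: k u => [|k IHk] u.
    by move/eqP; rewrite mdeg_eq0 => /eqP->; rewrite U1.
  move=> du uU; case: (boolP (mg u)) => [mu|].
    by exists u; rewrite ?inG // lepm_refl.
  rewrite /mg uU /= negb_forall => /existsP[i]; rewrite negb_imply.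
  case/andP=> lei nU.
  have [|//|v vG le_v] := IHk (u - U_(i))%MM.
    have := congr1 (@mdeg m) (submK lei).
    by rewrite mdegD mdeg1 du addn1 => -[].
  by exists v => //; apply: lepm_trans le_v _; rewrite -{2}(submK lei) lem_addr.
have genG : generated_by_monomials (ideal_of K U) G.
  move=> p; split; apply: monomial_ideal_trans => u.
    by move=> uU; apply: (belowG (mdeg u)).
  by rewrite inG => /andP[uU _]; exists u; rewrite ?lepm_refl.
exists G; split=> // H; rewrite fproperE => /andP[sHG /fsubsetPn[u uG uH]] genH.
have /genH/monomial_ideal_msupp : ideal_of K U ('X_[u] : {mpoly K[m]}).
  by apply/genG/(monomial_idealX (v := u)); rewrite ?lepm_refl.
case/(_ u); first by rewrite msuppX mem_seq1.
move=> v vH le_vu.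
have ne_vu : v != u by apply: contraNneq uH => <-.
have [i lt_vu] : exists i, (v i < u i)%N.
  apply/existsP; apply: contraNT ne_vu; rewrite negb_exists => /forallP le_uv.
  apply/eqP/mnmP=> i; apply/eqP; rewrite eqn_leq (mnm_lepP le_vu).
  by rewrite leqNgt le_uv.
have := fsubsetP sHG v vH; rewrite inG => /andP[/negP vU _]; apply: vU.
move: uG; rewrite inG => /andP[_ /forallP/(_ i)].
rewrite lep1mP -lt0n (leq_ltn_trans _ lt_vu) //= => /divU; apply.
apply/mnm_lepP=> k; rewrite mnmBE mnm1E; case: eqP => [<-|_].
  by rewrite subn1 -ltnS prednK // (leq_ltn_trans _ lt_vu).
by rewrite subn0; apply: mnm_lepP.
Qed.

End MinimalGenerators.

(* Main.v *)
Require Import Defs.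
From mathcomp Require Import all_boot all_order all_algebra finmap.
From mathcomp Require Import mpoly.
From mathcomp Require Import zify.

Set Implicit Arguments.
Unset Strict Implicit.
Unset Printing Implicit Defensive.

Import GRing.Theory.
Local Open Scope ring_scope.

(** Write a monomial of degree [s] as a sorted word with letters
    [e_0 <= ... <= e_(s-1)], counted from 0, and stretch it to the squarefree
    monomial with variables at the places [e_l + l + min(l, t)].

    The stretched minimal generators of [I(U)] generate the Stanley-Reisner ideal.
    If the places of a word [w] lie in the facet of [u], then [w] is at most as long
    as [u] and dominates a prefix of [u] letter by letter
    ([places_in_facet]), so [w] lies in the shifted ideal [U]; hence stretched
    generators are nonfaces ([stretch_nonface]).  Conversely, reading a set of
    vertices greedily from the left produces a word whose places lie in the set;
    either the set lies in the facet of this word, or the word is outside [U] and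
    one of its prefixes is a generator ([nonface_stretch]).

    The stretched generators, ordered by degree and then by the sum of the letters,
    have linear quotients: the colon ideal of the generators before [u] by [u] is
    generated by [max(u) - 1] variables, one for each letter [k] less than the
    last letter of [u] ([stretch_colon]).  This is the Eliahou-Kervaire description
    of strongly stable ideals, carried through the stretching.

    For linear quotients, adding one generator is a mapping cone over a Koszul
    complex.  Since degrees increase, the cones stay minimal
    ([minimal_betti_cone]), and the generator [u] contributes
    ['C(max(u) - 1, i)] basis vectors of degree [deg u + i] in position [i]
    ([minimal_betti_linear_quotients]).  The Koszul complexes are themselves
    iterated mapping cones ([minimal_betti_variables]).

    That these numbers do not depend on the resolution is the comparison theorem:
    two resolutions are homotopy equivalent, by homogeneous maps, so Tor has the
    same dimensions in every degree ([tor_dim_unique]). *)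

(** * Homogeneous matrices of polynomials *)

Section HomogeneousParts.

Variables (K : fieldType) (n : nat).
Implicit Types (p q : {mpoly K[n]}) (d e : int).

Definition homog_of e p := all (fun u => (mdeg u)%:Z == e) (msupp p).

Definition hpart e p : {mpoly K[n]} :=
  \sum_(u <- msupp p | (mdeg u)%:Z == e) p@_u *: 'X_[u].

Lemma homogP e p :
  reflect (forall u, u \in msupp p -> (mdeg u)%:Z = e) (homog_of e p).
Proof. by apply: (iffP allP) => h u up; apply/eqP; rewrite h. Qed.

Lemma homog0 e : homog_of e (0 : {mpoly K[n]}).
Proof. by rewrite /homog_of msupp0. Qed.

Lemma homogX e u : homog_of e ('X_[u] : {mpoly K[n]}) = ((mdeg u)%:Z == e).
Proof. by rewrite /homog_of msuppX /= andbT. Qed.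

Lemma homog1 : homog_of 0 (1 : {mpoly K[n]}).
Proof. by rewrite -mpolyX0 homogX mdeg0. Qed.

Lemma homogN e p : homog_of e (- p) = homog_of e p.
Proof. by rewrite /homog_of (perm_all _ (msuppN p)). Qed.

Lemma homogD e p q : homog_of e p -> homog_of e q -> homog_of e (p + q).
Proof.
move=> /homogP hp /homogP hq; apply/homogP => u /msuppD_le.
by rewrite mem_cat => /orP[/hp|/hq].
Qed.

Lemma homogM d e p q : homog_of d p -> homog_of e q -> homog_of (d + e) (p * q).
Proof.
move=> /homogP hp /homogP hq; apply/homogP => u /msuppM_le/allpairsP.
by case=> -[a b] /= [/hp <- /hq <- ->]; rewrite mdegD PoszD.
Qed.

Lemma homog_sum e (I : Type) (r : seq I) (P : pred I) (F : I -> {mpoly K[n]}) :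
  (forall i, P i -> homog_of e (F i)) -> homog_of e (\sum_(i <- r | P i) F i).
Proof. by move=> hF; elim/big_ind: _ => //; [apply: homog0|apply: homogD]. Qed.

Lemma homog_const e p : homog_of e p -> p@_0 != 0 -> e = 0.
Proof. by move=> /homogP hp; rewrite -mcoeff_msupp => /hp <-; rewrite mdeg0. Qed.

Lemma mcoeff_hpart e p u :
  (hpart e p)@_u = if (mdeg u)%:Z == e then p@_u else 0.
Proof.
rewrite /hpart raddf_sum /=.
under eq_bigr do rewrite mcoeffZ mcoeffX.
case: (boolP (u \in msupp p)) => [up|uNp].
  case: ifP => [du|dNu].
    rewrite (big_rem u) //= du eqxx mulr1 big_seq_cond big1 ?addr0 // => v.
    rewrite (mem_rem_uniq _ (msupp_uniq p)) => /andP[/andP[vu _] _].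
    by rewrite (negbTE vu) mulr0.
  rewrite big1 // => v dv; case: eqP => [vu|]; last by rewrite mulr0.
  by rewrite vu dNu in dv.
rewrite (memN_msupp_eq0 uNp) if_same big_seq_cond big1 // => v /andP[vp _].
by case: eqP => [vu|]; rewrite ?mulr0 //; rewrite vu (negbTE uNp) in vp.
Qed.

Lemma hpart_homog e p : homog_of e (hpart e p).
Proof.
apply/homogP => u; rewrite mcoeff_msupp mcoeff_hpart.
by case: ifP => [/eqP|]; rewrite ?eqxx.
Qed.

Lemma hpart_id e p : homog_of e p -> hpart e p = p.
Proof.
move=> /homogP hp; apply/mpolyP => u; rewrite mcoeff_hpart; case: ifP => // du.
by apply/esym/eqP; rewrite mcoeff_eq0; apply: contraFN du => /hp ->.
Qed.

Lemma hpartD e p q : hpart e (p + q) = hpart e p + hpart e q.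
Proof.
apply/mpolyP => u; rewrite mcoeffD !mcoeff_hpart mcoeffD.
by case: ifP; rewrite ?addr0.
Qed.

Lemma hpart_sum e (I : Type) (r : seq I) (F : I -> {mpoly K[n]}) :
  hpart e (\sum_(i <- r) F i) = \sum_(i <- r) hpart e (F i).
Proof.
elim/big_rec2: _ => [|i y x _ <-]; last by rewrite hpartD.
by rewrite hpart_id ?homog0.
Qed.

(** Splitting off the part of degree [d] of [p] leaves terms of other degrees
    only, and multiplying by [q] shifts all degrees by the same amount. *)
Lemma hpartM d e p q : homog_of e q -> hpart (d + e) (p * q) = hpart d p * q.
Proof.
move=> hq; set r := p - hpart d p.
rewrite -[p in p * q](subrK (hpart d p)) -/r mulrDl hpartD.
rewrite (hpart_id (homogM (hpart_homog d p) hq)).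
suff -> : hpart (d + e) (r * q) = 0 by rewrite add0r.
apply/mpolyP => u; rewrite mcoeff_hpart mcoeff0; case: eqP => // du.
apply: memN_msupp_eq0; apply/negP => /msuppM_le/allpairsP[[a b] /= [ar bq def_u]].
move: ar; rewrite mcoeff_msupp /r mcoeffB mcoeff_hpart.
case: ((mdeg a)%:Z =P d) => [_|da]; first by rewrite subrr eqxx.
case: da; move: du; rewrite def_u mdegD PoszD (homogP _ _ hq _ bq).
by move/addIr.
Qed.

End HomogeneousParts.

Section HomogeneousMatrices.

Variables (K : fieldType) (n : nat).
Local Notation P := {mpoly K[n]}.

(** These are the degree preserving maps, acting on row vectors, from the direct
    sum of the [P(- sa k)] to the direct sum of the [P(- sb l)]. *)
Definition homog_mx a b (sa : 'I_a -> int) (sb : 'I_b -> int) (M : 'M[P]_(a, b)) :=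
  [forall k, forall l, homog_of (sa k - sb l) (M k l)].

Lemma homog_mxP a b (sa : 'I_a -> int) (sb : 'I_b -> int) (M : 'M[P]_(a, b)) :
  reflect (forall k l, homog_of (sa k - sb l) (M k l)) (homog_mx sa sb M).
Proof.
apply: (iffP forallP) => [h k l|h k]; first exact: (forallP (h k)).
exact/forallP.
Qed.

Lemma homog_mx0 a b (sa : 'I_a -> int) (sb : 'I_b -> int) :
  homog_mx sa sb (0 : 'M[P]_(a, b)).
Proof. by apply/homog_mxP => k l; rewrite mxE homog0. Qed.

Lemma homog_mx1 a (sa : 'I_a -> int) : homog_mx sa sa (1%:M : 'M[P]_a).
Proof.
apply/homog_mxP => k l; rewrite mxE; case: eqP => [->|_].
  by rewrite subrr homog1.
by rewrite homog0.
Qed.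

Lemma homog_mxN a b (sa : 'I_a -> int) (sb : 'I_b -> int) (M : 'M[P]_(a, b)) :
  homog_mx sa sb (- M) = homog_mx sa sb M.
Proof. by apply: eq_forallb => k; apply: eq_forallb => l; rewrite mxE homogN. Qed.

Lemma homog_mxD a b (sa : 'I_a -> int) (sb : 'I_b -> int) (M N : 'M[P]_(a, b)) :
  homog_mx sa sb M -> homog_mx sa sb N -> homog_mx sa sb (M + N).
Proof.
move=> /homog_mxP hM /homog_mxP hN; apply/homog_mxP => k l.
by rewrite mxE homogD.
Qed.

Lemma homog_mxM a b c (sa : 'I_a -> int) (sb : 'I_b -> int) (sc : 'I_c -> int)
    (M : 'M[P]_(a, b)) (N : 'M[P]_(b, c)) :
  homog_mx sa sb M -> homog_mx sb sc N -> homog_mx sa sc (M *m N).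
Proof.
move=> /homog_mxP hM /homog_mxP hN; apply/homog_mxP => k l.
rewrite mxE; apply: homog_sum => i _.
by rewrite (_ : _ - _ = (sa k - sb i) + (sb i - sc l)) ?homogM // addrA subrK.
Qed.

Definition in_rows b c (D : 'M[P]_(b, c)) (v : 'rV_c) := exists w, v = w *m D.

(** A lift through [D] exists row by row, but need not preserve degrees.
    Replacing each entry by its part of the right degree gives a homogeneous
    matrix that is still a lift, because [D] and [M] are homogeneous. *)
Lemma homog_lift a b c (sa : 'I_a -> int) (sb : 'I_b -> int) (sc : 'I_c -> int)
    (D : 'M[P]_(b, c)) (M : 'M[P]_(a, c)) :
  homog_mx sb sc D -> homog_mx sa sc M ->
  (forall v, in_rows D (v *m M)) ->
  exists W, homog_mx sa sb W && (M == W *m D).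
Proof.
move=> /homog_mxP hD /homog_mxP hM MD.
have /fin_all_exists[w wP] : forall k, exists w : 'rV_b, row k M = w *m D.
  by move=> k; have [w] := MD (delta_mx 0 k); rewrite -rowE; exists w.
exists (\matrix_(k, l) hpart (sa k - sb l) (w k 0 l)); apply/andP; split.
  by apply/homog_mxP => k l; rewrite mxE hpart_homog.
apply/eqP/matrixP => k j; rewrite -(hpart_id (hM k j)).
have -> : M k j = (row k M) 0 j by rewrite mxE.
rewrite wP !mxE hpart_sum; apply: eq_bigr => l _; rewrite mxE.
by rewrite (_ : _ - _ = (sa k - sb l) + (sb l - sc j)) ?hpartM // addrA subrK.
Qed.

End HomogeneousMatrices.

(** * Comparison of graded free resolutions *)

Section TorComparison.

Variables (K : fieldType) (n : nat).
Local Notation P := {mpoly K[n]}.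
Local Notation k0 := (map_mx (mcoeff (0%MM : 'X_{1..n}))).

(** The differential [xdif] continues the resolution by the augmentation to [P],
    which sits in position 0 and has its generator in degree 0.  Constructions on
    resolutions then need no separate first step. *)
Definition xrk I (F : @graded_free_resolution K n I) i :=
  if i is i'.+1 then rk F i' else 1%N.

Definition xsh I (F : @graded_free_resolution K n I) i : 'I_(xrk F i) -> int :=
  match i return 'I_(xrk F i) -> int with
  | 0 => fun=> 0
  | i'.+1 => @sh K n I F i'
  end.

Definition xdif I (F : @graded_free_resolution K n I) i :
    'M[P]_(xrk F i.+1, xrk F i) :=
  match i return 'M[P]_(xrk F i.+1, xrk F i) with
  | 0 => aug F
  | i'.+1 => dif F i'
  end.

Lemma xdif_homog I (F : @graded_free_resolution K n I) i :
  homog_mx (@xsh I F i.+1) (@xsh I F i) (xdif F i).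
Proof.
apply/homog_mxP => k l; apply/homogP; case: i k l => [|i] /= k l u uM.
  by move: uM; rewrite (ord1 l) => /aug_homog ->; rewrite subr0.
by rewrite -(dif_homog uM) addrK.
Qed.

Lemma xdif_exact I (F : @graded_free_resolution K n I) i (v : 'rV_(xrk F i.+1)) :
  v *m xdif F i = 0 <-> in_rows (xdif F i.+1) v.
Proof. by case: i v => [|i] v; [apply: exact_aug|apply: exact_dif]. Qed.

Lemma xdif_comp I (F : @graded_free_resolution K n I) i :
  xdif F i.+1 *m xdif F i = 0.
Proof.
apply/row_matrixP => k; rewrite row0 rowE mulmxA.
by apply/xdif_exact; exists (delta_mx 0 k).
Qed.

Lemma xdif0_onto I (F : @graded_free_resolution K n I) (v : 'rV_1) :
  in_rows (xdif F 0) v <-> I (v 0 0).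
Proof.
split=> [[w ->]|/(aug_onto F)[w def_v]]; first by apply/(aug_onto F); exists w.
by exists w; apply/matrixP => k l; rewrite !ord1.
Qed.

(** The state of the inductive construction, in degree [i], of chain maps
    [phi] and [psi] between two resolutions of the same ideal and of a homotopy
    [h] from the identity to [phi psi].  The equation says that the part of
    [phi psi - 1] not accounted for by [h d] vanishes on boundaries. *)
Definition comparison_step I (E F : @graded_free_resolution K n I) i
    (phi : 'M[P]_(xrk E i, xrk F i)) (psi : 'M[P]_(xrk F i, xrk E i))
    (h : 'M[P]_(xrk E i, xrk E i.+1)) : Prop :=
  [/\ [/\ homog_mx (@xsh I E i) (@xsh I F i) phi,
          homog_mx (@xsh I F i) (@xsh I E i) psi
        & homog_mx (@xsh I E i) (@xsh I E i.+1) h],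
      forall v, in_rows (xdif F i) (v *m (xdif E i *m phi)),
      forall v, in_rows (xdif E i) (v *m (xdif F i *m psi)),
      xdif E i *m (phi *m psi - 1%:M - h *m xdif E i) = 0
    & i = 0%N -> h = 0].

(** Position 0 of both augmented complexes is [P], and the images of both
    augmentations are [I]. *)
Lemma comparison_step0 I (E F : @graded_free_resolution K n I) :
  @comparison_step I E F 0 1%:M 1%:M 0.
Proof.
split=> //; first by split; rewrite ?homog_mx0 ?homog_mx1.
- by move=> v; apply/xdif0_onto/(xdif0_onto E); exists v; rewrite mulmx1.
- by move=> v; apply/xdif0_onto/(xdif0_onto F); exists v; rewrite mulmx1.
- by rewrite mulmx1 subrr mul0mx subrr mulmx0.
Qed.

(** Exactness lifts [phi] and [psi] one position up.  The new
    [phi psi - 1 - d h] takes values in cycles, by the equation of the previous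
    state, so it factors through the next differential. *)
Lemma comparison_stepS I (E F : @graded_free_resolution K n I) i phi psi h :
  @comparison_step I E F i phi psi h ->
  exists phi' psi' h', [/\ @comparison_step I E F i.+1 phi' psi' h',
    xdif E i *m phi = phi' *m xdif F i, xdif F i *m psi = psi' *m xdif E i
    & phi' *m psi' = 1%:M + xdif E i *m h + h' *m xdif E i.+1].
Proof.
case=> -[hphi hpsi hh] imphi impsi cyc _.
have dE := xdif_homog E; have dF := xdif_homog F.
have [phi' /andP[hphi' /eqP e1]] :=
  homog_lift (dF i) (homog_mxM (dE i) hphi) imphi.
have [psi' /andP[hpsi' /eqP e2]] :=
  homog_lift (dE i) (homog_mxM (dF i) hpsi) impsi.
pose r := phi' *m psi' - 1%:M - xdif E i *m h.
have hr : homog_mx (@xsh I E i.+1) (@xsh I E i.+1) r.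
  rewrite !homog_mxD ?homog_mxN ?homog_mx1 //; first exact: homog_mxM hphi' _.
  exact: homog_mxM (dE i) _.
have r0 : r *m xdif E i = 0.
  rewrite /r !mulmxBl mul1mx -!mulmxA -e2 (mulmxA phi') -e1 -[RHS]cyc.
  by rewrite !mulmxBr mulmx1 !mulmxA.
have [|h' /andP[hh' /eqP e3]] := homog_lift (dE i.+1) hr.
  by move=> v; apply/xdif_exact; rewrite -mulmxA r0 mulmx0.
exists phi', psi', h'; split=> //; last first.
  by rewrite -e3 /r addrC -(addrA (phi' *m psi')) -opprD subrK.
split=> //.
- move=> v; apply/xdif_exact; rewrite -!mulmxA -e1 !(mulmxA (xdif E i.+1)).
  by rewrite xdif_comp !mul0mx mulmx0.
- move=> v; apply/xdif_exact; rewrite -!mulmxA -e2 !(mulmxA (xdif F i.+1)).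
  by rewrite xdif_comp !mul0mx mulmx0.
- have -> : phi' *m psi' - 1%:M - h' *m xdif E i.+1 = xdif E i *m h.
    by rewrite -e3 /r opprB addrC subrK.
  by rewrite mulmxA xdif_comp mul0mx.
Qed.

Lemma comparison_step_ex I (E F : @graded_free_resolution K n I) i :
  exists phi psi h, @comparison_step I E F i phi psi h.
Proof.
elim: i => [|i [phi [psi [h /comparison_stepS[phi' [psi' [h' [st _ _ _]]]]]]]].
  by exists 1%:M, 1%:M, 0; apply: comparison_step0.
by exists phi', psi', h'.
Qed.

(** The projection of a graded vector space to its part of degree [j]. *)
Definition piece a (s : 'I_a -> int) j : 'M[K]_a :=
  diag_mx (\row_k (s k == j)%:R).

(** A nonzero constant term in a homogeneous matrix links two basis vectors of
    the same degree, so tensoring with [K] splits it into its degree parts. *)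
Lemma piece_comm a b (sa : 'I_a -> int) (sb : 'I_b -> int) (M : 'M[P]_(a, b)) j :
  homog_mx sa sb M -> piece sa j *m k0 M = k0 M *m piece sb j.
Proof.
move=> /homog_mxP hM; apply/matrixP => k l.
rewrite mul_diag_mx mul_mx_diag !mxE; have [->|nz] := eqVneq (M k l)@_0 0.
  by rewrite mulr0 mul0r.
by rewrite mulrC (subr0_eq (homog_const (hM k l) nz)).
Qed.

Lemma piece_idem a (s : 'I_a -> int) j : piece s j *m piece s j = piece s j.
Proof.
rewrite /piece mulmx_diag; congr diag_mx; apply/rowP => k; rewrite !mxE.
by rewrite -natrM mulnb andbb.
Qed.

Lemma sub_pieceP a (s : 'I_a -> int) j (v : 'rV[K]_a) :
  reflect (v *m piece s j = v) (v <= piece s j)%MS.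
Proof.
apply: (iffP idP) => [/submxP[w ->]|<-]; last exact: submxMl.
by rewrite -mulmxA piece_idem.
Qed.

Lemma sub_tor_cyclesP I (F : @graded_free_resolution K n I) i j
    (v : 'rV[K]_(xrk F i.+1)) :
  (v <= tor_cycles F i j)%MS <->
  v *m piece (@xsh I F i.+1) j = v /\ ((0 < i)%N -> v *m k0 (xdif F i) = 0).
Proof.
case: i v => [|i] v; first by split=> [/sub_pieceP|[/sub_pieceP]].
rewrite /= sub_capmx; split=> [/andP[/sub_pieceP ? /sub_kermxP]|[? k]] //.
by apply/andP; split; [apply/sub_pieceP|apply/sub_kermxP; rewrite k].
Qed.

Lemma sub_tor_boundariesP I (F : @graded_free_resolution K n I) i j
    (v : 'rV[K]_(xrk F i.+1)) :
  (v <= tor_boundaries F i j)%MS <->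
  exists w, v = w *m (piece (@xsh I F i.+2) j *m k0 (xdif F i.+1)).
Proof. by split=> [/submxP|[w ->]] //; apply: submxMl. Qed.

(** The third hypothesis makes the map from [C / B] to [C' / B'] induced by [f]
    injective; composing with the cokernel of [B'] turns this into ranks. *)
Lemma subquotient_rank_le a b c a' b' c' (C : 'M[K]_(c, a)) (B : 'M[K]_(b, a))
    (C' : 'M[K]_(c', a')) (B' : 'M[K]_(b', a')) (f : 'M[K]_(a, a')) :
  (C *m f <= C')%MS -> (B' <= C')%MS ->
  (forall v : 'rV_a, (v <= C)%MS -> (v *m f <= B')%MS -> (v <= B)%MS) ->
  (\rank C - \rank B <= \rank C' - \rank B')%N.
Proof.
move=> Cf BC inj; pose g := f *m cokermx B'.
have rC := mxrank_mul_ker C g; have rC' := mxrank_mul_ker C' (cokermx B').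
have kB : (\rank (C :&: kermx g) <= \rank B)%N.
  apply/mxrankS/rV_subP => v; rewrite sub_capmx => /andP[vC /sub_kermxP vg].
  by apply: inj => //; rewrite submxE -mulmxA vg.
have B'k : (\rank B' <= \rank (C' :&: kermx (cokermx B')))%N.
  by apply: mxrankS; rewrite sub_capmx BC; apply/sub_kermxP/mulmx_coker.
have le : (\rank (C *m g) <= \rank (C' *m cokermx B'))%N.
  by rewrite mulmxA mxrankS // submxMr.
lia.
Qed.

(** A chain map [phi] with a left inverse [psi] up to homotopy is injective on
    homology, after tensoring with [K] and in each degree. *)
Lemma tor_dim_le I (E F : @graded_free_resolution K n I) i j :
  (tor_dim E i j <= tor_dim F i j)%N.
Proof.
have [phi [psi [h st]]] := comparison_step_ex E F i.
have [phi' [psi' [h' [st' c1 c2 hom]]]] := comparison_stepS st.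
have [_ [psi'' [_ [[[_ hpsi'' _] _ _ _ _] _ c3 _]]]] := comparison_stepS st'.
case: st => _ _ _ _ h0; case: st' => -[hphi' hpsi' hh'] _ _ _ _.
have homk : k0 phi' *m k0 psi' =
    1%:M + k0 (xdif E i) *m k0 h + k0 h' *m k0 (xdif E i.+1).
  by rewrite -map_mxM hom !map_mxD map_mx1 !map_mxM.
have c1k : k0 (xdif E i) *m k0 phi = k0 phi' *m k0 (xdif F i).
  by rewrite -!map_mxM c1.
have c3k : k0 (xdif F i.+1) *m k0 psi' = k0 psi'' *m k0 (xdif E i.+1).
  by rewrite -!map_mxM c3.
have ddk : k0 (xdif F i.+1) *m k0 (xdif F i) = 0.
  by rewrite -map_mxM xdif_comp map_mx0.
apply: (subquotient_rank_le (f := k0 phi')).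
- apply/rV_subP => _ /submxP[w ->]; rewrite mulmxA.
  have /sub_tor_cyclesP[vp vk] := submxMl w (tor_cycles E i j).
  apply/sub_tor_cyclesP; split=> [|i0].
    by rewrite -mulmxA -(piece_comm j hphi') mulmxA vp.
  by rewrite -mulmxA -c1k mulmxA vk // mul0mx.
- apply/rV_subP => _ /sub_tor_boundariesP[w ->]; apply/sub_tor_cyclesP.
  have dp := piece_comm j (xdif_homog F i.+1).
  split=> [|i0]; first by rewrite -!mulmxA -dp (mulmxA (piece _ _)) piece_idem.
  by rewrite -!mulmxA ddk !mulmx0.
- move=> v /sub_tor_cyclesP[vp vk] /sub_tor_boundariesP[w def_w].
  apply/sub_tor_boundariesP; exists (w *m k0 psi'' - v *m k0 h').
  have e1 : w *m k0 psi'' *m (piece (@xsh I E i.+2) j *m k0 (xdif E i.+1)) =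
      v *m (k0 phi' *m k0 psi').
    rewrite mulmxA -(mulmxA w) -(piece_comm j hpsi'') (mulmxA v) def_w.
    by rewrite -!mulmxA c3k.
  have e2 : v *m k0 h' *m (piece (@xsh I E i.+2) j *m k0 (xdif E i.+1)) =
      v *m (k0 h' *m k0 (xdif E i.+1)).
    by rewrite mulmxA -(mulmxA v) -(piece_comm j hh') mulmxA vp -mulmxA.
  (* In position 0 every vector is a cycle for Tor although the augmentation
     need not kill it; there the homotopy [h] is zero instead. *)
  have vdh : v *m (k0 (xdif E i) *m k0 h) = 0.
    case: (posnP i) => [i0|/vk vd0]; last by rewrite mulmxA vd0 mul0mx.
    by rewrite h0 // map_mx0 !mulmx0.
  by rewrite mulmxBl e1 e2 homk !mulmxDr mulmx1 vdh addr0 addrK.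
Qed.

Lemma tor_dim_unique I (E F : @graded_free_resolution K n I) i j :
  tor_dim E i j = tor_dim F i j.
Proof. by apply/eqP; rewrite eqn_leq !tor_dim_le. Qed.

End TorComparison.

(** * Minimal resolutions and mapping cones *)

Section MappingCone.

Variables (K : fieldType) (n : nat).
Local Notation P := {mpoly K[n]}.
Local Notation k0 := (map_mx (mcoeff (0%MM : 'X_{1..n}))).

(** A minimal resolution determines its own Betti numbers: tensoring it with [K]
    makes all differentials vanish, so [b] counts basis vectors. *)
Definition minimal_betti (I : P -> Prop) (b : nat -> int -> nat) : Prop :=
  exists F : graded_free_resolution I, (forall i, tensor_dif F i = 0) /\
    forall i j, (\sum_(k < rk F i) (sh k == j))%N = b i j.

(** The projection factors as [S^T S], where the rows of [S] are the distinct
    basis vectors of degree [j], so that [S S^T = 1]. *)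
Lemma rank_piece a (s : 'I_a -> int) j :
  \rank (piece K s j) = (\sum_(k < a) (s k == j))%N.
Proof.
pose T := [pred k | s k == j]; pose f (i : 'I_#|T|) : 'I_a := enum_val i.
pose S : 'M[K]_(#|T|, a) := \matrix_(i, k) (f i == k)%:R.
have SS : S *m S^T = 1%:M.
  apply/matrixP => i i'; rewrite !mxE (bigD1 (f i)) //= !mxE eqxx mul1r big1.
    by rewrite addr0 (inj_eq enum_val_inj) eq_sym.
  by move=> k nk; rewrite !mxE eq_sym (negbTE nk) mul0r.
have -> : piece K s j = S^T *m S.
  apply/matrixP => k l; rewrite !mxE; case: (boolP (k \in T)) => [kT|kNT].
    have fk : f (enum_rank_in kT k) = k by rewrite /f enum_rankK_in.
    rewrite (bigD1 (enum_rank_in kT k)) //= !mxE fk eqxx mul1r big1 ?addr0.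
      by rewrite (eqP kT) eqxx; case: (k == l).
    move=> i ni; rewrite !mxE; case: eqP => [fi|]; last by rewrite mul0r.
    by case/eqP: ni; apply: enum_val_inj; apply: etrans fi (esym fk).
  rewrite big1 => [|i _]; first by rewrite -[_ == j]/(k \in T) (negbTE kNT) mul0rn.
  rewrite !mxE; case: eqP => [fi|]; last by rewrite mul0r.
  by case/negP: kNT; rewrite -fi; apply: enum_valP.
rewrite mxrankMfree ?mxrank_tr; last first.
  by apply/row_freeP; exists S^T.
have /eqP -> : row_free S by apply/row_freeP; exists S^T.
by rewrite -sum1_card big_mkcond.
Qed.

Lemma tor_dim_minimal I (F : @graded_free_resolution K n I) i j :
  (forall i, tensor_dif F i = 0) -> tor_dim F i j = (\sum_(k < rk F i) (sh k == j))%N.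
Proof.
move=> F0; rewrite /tor_dim /tor_boundaries F0 mulmx0 mxrank0 subn0 -rank_piece.
case: i => [|i] //; apply/eqP; rewrite eqn_leq.
rewrite !mxrankS ?capmxSl // sub_capmx submx_refl F0.
by apply/sub_kermxP; rewrite mulmx0.
Qed.

Lemma graded_betti_of_minimal I b i j : minimal_betti I b ->
  @graded_betti_number K n I i j (b i j).
Proof.
case=> F [F0 bF]; split; first by exists.
by move=> F'; rewrite (tor_dim_unique F' F) tor_dim_minimal.
Qed.

(** The ideal enters the notion of resolution only through the image of the
    augmentation. *)
Lemma minimal_betti_ext (I I' : P -> Prop) b b' :
  (forall p, I p <-> I' p) -> (forall i j, b i j = b' i j) ->
  minimal_betti I b -> minimal_betti I' b'.
Proof.
move=> eqI eqb [F [F0 Fb]].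
have onto p : I' p <-> exists v : 'rV_(rk F 0), p = (v *m aug F) 0 0.
  by rewrite -eqI; apply: aug_onto.
exists (GradedFreeResolution (@dif_homog _ _ _ F) (@aug_homog _ _ _ F) onto
  (@exact_aug _ _ _ F) (@exact_dif _ _ _ F)); split; first exact: F0.
by move=> i j; rewrite -eqb -Fb.
Qed.

Lemma minimal_betti0 : minimal_betti (fun p => p = 0) (fun _ _ => 0%N).
Proof.
have onto (p : P) : p = 0 <-> exists v : 'rV_0, p = (v *m (0 : 'cV_0)) 0 0.
  by split=> [->|[v ->]]; [exists 0|]; rewrite mulmx0 mxE.
have ex c (v : 'rV[P]_0) :
    v *m (0 : 'M_(0, c)) = 0 <-> exists w : 'rV_0, v = w *m (0 : 'M_0).
  by split=> _; [exists 0|]; rewrite ?mulmx0 // [LHS]thinmx0.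
exists (@GradedFreeResolution K n _ (fun=> 0%N) (fun _ _ => 0) (fun=> 0) 0
  (fun i k => match notF (ltn_ord k) with end)
  (fun k => match notF (ltn_ord k) with end) onto (ex 1%N) (fun=> ex 0%N)).
split=> [i|i j] /=; first exact: flatmx0.
by rewrite big_ord0.
Qed.

Definition sum_sh a b (sa : 'I_a -> int) (sb : 'I_b -> int) (k : 'I_(a + b)) : int :=
  match split k with inl i => sa i | inr i => sb i end.

Lemma sum_shl a b (sa : 'I_a -> int) (sb : 'I_b -> int) k :
  sum_sh sa sb (lshift b k) = sa k.
Proof. by rewrite /sum_sh (unsplitK (inl k)). Qed.

Lemma sum_shr a b (sa : 'I_a -> int) (sb : 'I_b -> int) k :
  sum_sh sa sb (rshift a k) = sb k.
Proof. by rewrite /sum_sh (unsplitK (inr k)). Qed.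

Lemma homog_col_mx a b c (sa : 'I_a -> int) (sb : 'I_b -> int) (sc : 'I_c -> int)
    (A : 'M[P]_(a, c)) (B : 'M[P]_(b, c)) :
  homog_mx sa sc A -> homog_mx sb sc B -> homog_mx (sum_sh sa sb) sc (col_mx A B).
Proof.
move=> /homog_mxP hA /homog_mxP hB; apply/homog_mxP => k l.
by rewrite mxE /sum_sh; case: (split k).
Qed.

Lemma homog_row_mx a b c (sa : 'I_a -> int) (sb : 'I_b -> int) (sc : 'I_c -> int)
    (A : 'M[P]_(c, a)) (B : 'M[P]_(c, b)) :
  homog_mx sc sa A -> homog_mx sc sb B -> homog_mx sc (sum_sh sa sb) (row_mx A B).
Proof.
move=> /homog_mxP hA /homog_mxP hB; apply/homog_mxP => k l.
by rewrite mxE /sum_sh; case: (split l).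
Qed.

Lemma homog_mx_shift a b (sa : 'I_a -> int) (sb : 'I_b -> int) d (M : 'M[P]_(a, b)) :
  homog_mx (fun k => sa k + d) (fun k => sb k + d) M = homog_mx sa sb M.
Proof.
by apply: eq_forallb => k; apply: eq_forallb => l; rewrite opprD addrACA subrr addr0.
Qed.

(** For [C] the colon ideal of [J] by [x^w], multiplication by [x^w] embeds
    [P / C], shifted by the degree of [x^w], into [P / J] with cokernel [P / J'].
    Hence the mapping cone of a lift of this multiplication to the augmented
    resolutions resolves [J']. *)
Section Cone.

Variables (J C J' : P -> Prop) (w : 'X_{1..n}).
Variables (E : graded_free_resolution J) (Q : graded_free_resolution C).
Hypothesis colon : forall a, C a <-> J (a * 'X_[w]).
Hypothesis J'E : forall p, J' p <-> exists q a, J q /\ p = q + a * 'X_[w].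

Local Notation D := (mdeg w)%:Z.
Local Notation shQ := (fun i k => @xsh K n C Q i k + D).

Definition cone_map_spec i (M : 'M[P]_(xrk Q i, xrk E i)) : Prop :=
  homog_mx (shQ i) (@xsh _ _ _ E i) M /\
  forall v, in_rows (xdif E i) (v *m (xdif Q i *m M)).

Lemma cone_map_base : @cone_map_spec 0 ('X_[w])%:M.
Proof.
split; first by apply/homog_mxP => k l; rewrite !ord1 mxE eqxx add0r subr0 homogX.
move=> v; apply/xdif0_onto; rewrite mulmxA [_ *m _%:M]mul_mx_scalar mxE mulrC.
by apply/colon/(xdif0_onto Q); exists v.
Qed.

Lemma cone_map_lift i (M : 'M[P]_(xrk Q i, xrk E i)) : cone_map_spec M ->
  exists W, homog_mx (shQ i.+1) (@xsh _ _ _ E i.+1) W &&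
            (xdif Q i *m M == W *m xdif E i).
Proof.
case=> hM imM; apply: homog_lift (xdif_homog E i) _ imM.
by apply: homog_mxM hM; rewrite homog_mx_shift xdif_homog.
Qed.

Lemma cone_map_step i (M : 'M[P]_(xrk Q i, xrk E i)) W :
  homog_mx (shQ i.+1) (@xsh _ _ _ E i.+1) W && (xdif Q i *m M == W *m xdif E i) ->
  cone_map_spec W.
Proof.
case/andP=> hW /eqP eW; split=> // v; apply/xdif_exact.
by rewrite -!mulmxA -eW (mulmxA (xdif Q i.+1)) xdif_comp mul0mx mulmx0.
Qed.

(** Each component of the chain map depends on a choice made for the previous
    one, so the choices are made along a recursion that carries the
    specification with the matrix. *)
Definition cone_map_state i : {M : 'M[P]_(xrk Q i, xrk E i) | cone_map_spec M} :=
  nat_rect (fun i => {M : 'M[P]_(xrk Q i, xrk E i) | cone_map_spec M})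
    (exist _ _ cone_map_base)
    (fun i s => exist _ _ (cone_map_step (xchooseP (cone_map_lift (svalP s))))) i.

Definition cone_map i := sval (cone_map_state i).

Lemma cone_map_homog i : homog_mx (shQ i) (@xsh _ _ _ E i) (cone_map i).
Proof. by case: (svalP (cone_map_state i)). Qed.

Lemma cone_map_comm i : xdif Q i *m cone_map i = cone_map i.+1 *m xdif E i.
Proof.
exact: eqP (andP (xchooseP (cone_map_lift (svalP (cone_map_state i))))).2.
Qed.

Definition cone_rk i := (rk E i + xrk Q i)%N.

Definition cone_sh i : 'I_(cone_rk i) -> int := sum_sh (@sh _ _ _ E i) (shQ i).

Definition cone_dif i : 'M[P]_(cone_rk i.+1, cone_rk i) :=
  block_mx (dif E i) 0 (cone_map i.+1) (- xdif Q i).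

Definition cone_aug : 'cV[P]_(cone_rk 0) := col_mx (aug E) (cone_map 0).

Lemma cone_dif_homog i (k : 'I_(cone_rk i.+1)) (l : 'I_(cone_rk i)) u :
  u \in msupp (cone_dif i k l) -> (mdeg u)%:Z + cone_sh l = cone_sh k.
Proof.
have /homog_mxP/(_ k l)/homogP h :
    homog_mx (@cone_sh i.+1) (@cone_sh i) (cone_dif i).
  apply: homog_col_mx; apply: homog_row_mx.
  - exact: (xdif_homog E i.+1).
  - exact: homog_mx0.
  - exact: (cone_map_homog i.+1).
  - by rewrite homog_mxN (homog_mx_shift _ _ D) (xdif_homog Q i).
by move=> /h ->; rewrite subrK.
Qed.

Lemma cone_aug_homog (k : 'I_(cone_rk 0)) u :
  u \in msupp (cone_aug k 0) -> (mdeg u)%:Z = cone_sh k.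
Proof.
have /homog_mxP/(_ k 0)/homogP h :
    homog_mx (@cone_sh 0) (fun=> 0) cone_aug.
  by apply: homog_col_mx; [exact: (xdif_homog E 0)|exact: (cone_map_homog 0)].
by move=> /h ->; rewrite subr0.
Qed.

Lemma cone_aug_onto p : J' p <-> exists v : 'rV_(cone_rk 0), p = (v *m cone_aug) 0 0.
Proof.
rewrite J'E; split.
  move=> [q [a [/(aug_onto E)[x ->] ->]]]; exists (row_mx x a%:M : 'rV_(_ + 1)).
  by rewrite /cone_aug mul_row_col mul_scalar_mx !mxE eqxx.
case=> v ->; exists ((lsubmx v *m aug E) 0 0), ((rsubmx v : 'rV_1) 0 0); split.
  by apply/(aug_onto E); exists (lsubmx v).
rewrite -[in LHS](hsubmxK v) /cone_aug (mul_row_col (lsubmx v)) [LHS]mxE; congr (_ + _).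
by rewrite [_ *m cone_map 0]mul_mx_scalar mxE mulrC.
Qed.

(** If [y] is a boundary of [z], then [x] plus the image of [z] is a cycle of
    [E], hence a boundary.  Whether [y] is a boundary is seen differently in
    position 0, where it follows from [C] being the colon ideal. *)
Lemma cone_exact i (x : 'rV_(xrk E i.+1)) (y : 'rV_(xrk Q i)) :
  in_rows (xdif Q i) y -> x *m xdif E i + y *m cone_map i = 0 ->
  exists z : 'rV_(cone_rk i.+1), row_mx x y = z *m cone_dif i.
Proof.
case=> z ->; rewrite -mulmxA cone_map_comm mulmxA -mulmxDl.
move=> /xdif_exact[v def_v].
exists (row_mx v (- z)); rewrite /cone_dif mul_row_block.
rewrite mulNmx mulmxN mulNmx opprK mulmx0 add0r.
by rewrite -[X in row_mx (X - _)]def_v addrK.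
Qed.

Lemma cone_exact_aug (v : 'rV_(cone_rk 0)) :
  v *m cone_aug = 0 <-> exists z, v = z *m cone_dif 0.
Proof.
split=> [|[z ->]]; last first.
  rewrite -(hsubmxK z) /cone_dif mul_row_block /cone_aug mul_row_col mulmx0 add0r.
  rewrite mulmxDl -mulmxA (xdif_comp E 0) mulmx0 add0r mulmxN mulNmx.
  by rewrite -!mulmxA cone_map_comm subrr.
rewrite -(hsubmxK v) /cone_aug mul_row_col => v0.
suff yQ : in_rows (xdif Q 0) (rsubmx v : 'rV_1) by apply: cone_exact yQ v0.
apply/xdif0_onto/colon.
suff -> : (rsubmx v : 'rV_1) 0 0 * 'X_[w] = (- lsubmx v *m xdif E 0) 0 0.
  by apply/(xdif0_onto E); exists (- lsubmx v).
rewrite mulNmx (addr0_eq v0).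
by rewrite [_ *m cone_map 0]mul_mx_scalar [RHS]mxE mulrC.
Qed.

Lemma cone_exact_dif i (v : 'rV_(cone_rk i.+1)) :
  v *m cone_dif i = 0 <-> exists z, v = z *m cone_dif i.+1.
Proof.
split=> [|[z ->]]; last first.
  rewrite -(hsubmxK z) /cone_dif !mul_row_block !mulmx0 !add0r.
  rewrite mulmxDl -mulmxA (xdif_comp E i.+1) mulmx0 add0r !mulmxN !mulNmx opprK.
  by rewrite -!mulmxA cone_map_comm xdif_comp subrr mulmx0 row_mx0.
rewrite -(hsubmxK v) /cone_dif mul_row_block mulmx0 add0r -row_mx0.
move=> /eq_row_mx[v0 /eqP]; rewrite mulmxN oppr_eq0 => /eqP/xdif_exact yQ.
exact: cone_exact yQ v0.
Qed.

Definition cone_resolution : graded_free_resolution J' :=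
  GradedFreeResolution cone_dif_homog cone_aug_homog cone_aug_onto
    cone_exact_aug cone_exact_dif.

(** A constant in the chain map would link a basis vector of degree greater than
    [D + i] to one of degree at most [D + i]. *)
Lemma cone_minimal :
  (forall i, tensor_dif E i = 0) -> (forall i, tensor_dif Q i = 0) ->
  (forall i k, @sh _ _ _ E i k <= D + i%:Z) ->
  (forall i k, i.+1%:Z <= @sh _ _ _ Q i k) ->
  forall i, tensor_dif cone_resolution i = 0.
Proof.
move=> E0 Q0 shE shQ i; rewrite /tensor_dif /= /cone_dif map_block_mx.
have -> : map_mx (mcoeff 0%MM) (dif E i) = 0 by apply: E0.
have -> : k0 (- xdif Q i) = 0.
  rewrite map_mxN; case: i => [|i]; last by rewrite [map_mx _ _]Q0 oppr0.
  apply/matrixP => k l; rewrite !mxE /=; have [->|nz] := eqVneq (xdif Q 0 k l)@_0 0.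
    by rewrite oppr0.
  move: (shQ 0%N k); have := homog_const (homog_mxP _ _ _ (xdif_homog Q 0) k l) nz.
  by rewrite /= subr0 => ->.
have -> : k0 (cone_map i.+1) = 0.
  apply/matrixP => k l; rewrite !mxE.
  have [//|nz] := eqVneq (cone_map i.+1 k l)@_0 0.
  have := homog_const (homog_mxP _ _ _ (cone_map_homog i.+1) k l) nz.
  by have := shE i l; have := shQ i k; rewrite /=; lia.
by rewrite map_mx0 block_mx0.
Qed.

Lemma cone_count i j :
  (\sum_(k < rk cone_resolution i) (sh k == j) =
   \sum_(k < rk E i) (sh k == j) + \sum_(k < xrk Q i) (xsh k == (j - D)%R))%N.
Proof.
rewrite big_split_ord /=; congr (_ + _)%N; apply: eq_bigr => k _.
  by rewrite /cone_sh sum_shl.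
by rewrite /cone_sh sum_shr -subr_eq opprK.
Qed.

End Cone.

(** The bounds on [b] and [c] are what makes the mapping cone minimal, and then
    Betti numbers add up: those of [C] move up by one position and by the degree
    of [x^w], and [x^w] itself is one more generator. *)
Lemma minimal_betti_cone (J C J' : P -> Prop) (w : 'X_{1..n}) b c :
  (forall a, C a <-> J (a * 'X_[w])) ->
  (forall p, J' p <-> exists q a, J q /\ p = q + a * 'X_[w]) ->
  (forall i j, b i j != 0%N -> j <= (mdeg w)%:Z + i%:Z) ->
  (forall i j, c i j != 0%N -> i.+1%:Z <= j) ->
  minimal_betti J b -> minimal_betti C c ->
  minimal_betti J' (fun i j => (b i j +
    if i is i'.+1 then c i' (j - (mdeg w)%:Z)%R else j == (mdeg w)%:Z)%N).
Proof.
move=> colon J'E hb hc [E [E0 Eb]] [Q [Q0 Qc]].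
have sh_neq0 I (F : @graded_free_resolution K n I) i k :
    (\sum_(l < rk F i) (sh l == @sh _ _ _ F i k))%N != 0%N.
  by rewrite (bigD1 k) //= eqxx.
exists (cone_resolution E Q colon J'E); split.
  apply: cone_minimal => // i k; first by apply: hb; rewrite -Eb.
  by apply: hc; rewrite -Qc.
move=> i j; rewrite cone_count Eb; congr (_ + _)%N.
case: i => [|i] /=; last exact: Qc.
by rewrite big_ord1 eq_sym subr_eq0.
Qed.

End MappingCone.

(** * Monomial ideals with linear quotients *)

Section LinearQuotients.

Variables (K : fieldType) (n : nat).
Local Notation P := {mpoly K[n]}.
Implicit Types (S : 'X_{1..n} -> Prop) (u v w : 'X_{1..n}).

Lemma ideal_genD (R : comNzRingType) (S : R -> Prop) p q :
  ideal_gen S p -> ideal_gen S q -> ideal_gen S (p + q).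
Proof.
move=> [s [Ss ->]] [r [Sr ->]]; exists (s ++ r); rewrite big_cat; split=> // c.
by rewrite mem_cat => /orP[/Ss|/Sr].
Qed.

Lemma ideal_genM (R : comNzRingType) (S : R -> Prop) a p :
  ideal_gen S p -> ideal_gen S (a * p).
Proof.
move=> [s [Ss ->]]; exists [seq (a * c.1, c.2) | c <- s]; split.
  by move=> _ /mapP[c /Ss ? ->].
by rewrite big_map mulr_sumr; apply: eq_bigr => c _; rewrite mulrA.
Qed.

Lemma monomial_idealP S (p : P) :
  monomial_ideal S p <-> forall u, u \in msupp p -> exists2 v, S v & (v <= u)%MM.
Proof.
split=> [Sp u|]; first exact: monomial_ideal_msupp.
rewrite [in monomial_ideal _ p](mpolyE p); elim: (msupp p) => [|u s IHs] Ss.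
  by exists [::]; rewrite !big_nil.
rewrite big_cons; apply: ideal_genD; last first.
  by apply: IHs => v vs; apply: Ss; rewrite in_cons vs orbT.
have [v Sv vu] := Ss u (mem_head _ _); rewrite -mul_mpolyC.
exact/ideal_genM/(monomial_idealX _ Sv).
Qed.

Lemma eq_monomial_ideal S S' (p : P) :
  (forall u, (exists2 v, S v & (v <= u)%MM) <-> (exists2 v, S' v & (v <= u)%MM)) ->
  monomial_ideal S p <-> monomial_ideal S' p.
Proof.
by move=> eqS; rewrite !monomial_idealP; split=> h u up; apply/eqS/h.
Qed.

Lemma monomial_ideal_rcons (L : seq 'X_{1..n}) w (p : P) :
  monomial_ideal (fun u => u \in rcons L w) p <->
  exists q a, monomial_ideal (fun u => u \in L) q /\ p = q + a * 'X_[w].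
Proof.
split=> [[s [Ss ->]]|[q [a [Lq ->]]]].
  elim: s Ss => [|c s IHs] Ss.
    exists 0, 0; rewrite big_nil mul0r addr0; split=> //.
    by exists [::]; rewrite big_nil.
  have [|q [a [Lq sE]]] := IHs.
    by move=> d ds; apply: Ss; rewrite in_cons ds orbT.
  have [u] := Ss c (mem_head _ _); rewrite mem_rcons in_cons big_cons sE.
  case/orP=> [/eqP-> ->|uL ->].
    by exists q, (c.1 + a); rewrite mulrDl addrCA.
  exists (c.1 * 'X_[u] + q), a; rewrite addrA; split=> //.
  apply: ideal_genD Lq; apply: ideal_genM.
  exact: (@monomial_idealX K n _ u u uL (lepm_refl u)).
apply: ideal_genD.
  apply: monomial_ideal_trans Lq => u uL.
  by exists u; rewrite ?lepm_refl // mem_rcons in_cons uL orbT.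
apply: ideal_genM; apply: (@monomial_idealX K n _ w w _ (lepm_refl w)).
by rewrite mem_rcons mem_head.
Qed.

(** Multiplication by a monomial permutes monomials, so the colon ideal of a
    monomial ideal by a monomial can be tested on monomials. *)
Lemma monomial_ideal_colon S S' w (a : P) :
  (forall u, (exists2 v, S' v & (v <= u)%MM) <-> (exists2 v, S v & (v <= u + w)%MM)) ->
  monomial_ideal S' a <-> monomial_ideal S (a * 'X_[w]).
Proof.
move=> SS'; rewrite !monomial_idealP; split=> h u.
  rewrite (perm_mem (msuppMX _ _)) => /mapP[v /h/SS' ? ->].
  by rewrite addmC.
move=> ua; apply/SS'/h; rewrite (perm_mem (msuppMX _ _)) addmC.
exact: map_f.
Qed.

Lemma minimal_betti_nil :
  minimal_betti (@monomial_ideal K n (fun u => u \in [::])) (fun _ _ => 0%N).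
Proof.
apply: minimal_betti_ext (minimal_betti0 K n) => // p; rewrite monomial_idealP.
split=> [->|h]; first by rewrite msupp0.
apply/eqP; rewrite -msupp_eq0; case: (msupp p) h => // u s h.
by have [] := h u (mem_head _ _).
Qed.

(** The resolution built here is the Koszul complex: a variable is a nonzero
    divisor modulo the others, so the colon ideal is the ideal itself. *)
Lemma minimal_betti_variables (Y : seq 'I_n) : uniq Y ->
  minimal_betti (@monomial_ideal K n (fun u => u \in [seq U_(y)%MM | y <- Y]))
    (fun i j => (j == i.+1%:Z) * 'C(size Y, i.+1))%N.
Proof.
elim/last_ind: Y => [_|Y y IHY].
  by apply: minimal_betti_ext minimal_betti_nil => // i j; rewrite bin0n muln0.
rewrite rcons_uniq => /andP[yY /IHY bY].
have {}bY := minimal_betti_cone (w := U_(y)%MM) _ _ _ _ bY bY.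
pose I' := monomial_ideal (K := K) (fun u => u \in [seq U_(z)%MM | z <- rcons Y y]).
apply: minimal_betti_ext (bY I' _ _ _ _) => //.
- move=> i j; rewrite mdeg1 size_rcons binS.
  case: i => [|i]; first by rewrite bin0 mulnDr muln1.
  by rewrite mulnDr subr_eq (_ : i.+1%:Z + 1%:Z = i.+2%:Z) //; lia.
- move=> a; apply: monomial_ideal_colon => u; split=> -[_ /mapP[z zY ->] uz].
    by exists U_(z)%MM; [apply: map_f|apply: lepm_trans uz (lem_addr _ _)].
  exists U_(z)%MM; first exact: map_f.
  move: uz; rewrite !lep1mP mnmDE mnm1E; case: (y =P z) => [yz|]; last by rewrite addn0.
  by rewrite yz zY in yY.
- by move=> p; rewrite /I' map_rcons; apply: monomial_ideal_rcons.
- by move=> i j; rewrite mdeg1; case: (j =P _) => [-> _|]; rewrite ?mul0n //; lia.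
- by move=> i j; case: (j =P _) => [->|]; rewrite ?mul0n.
Qed.

(** Adding the generators one at a time, each step is a mapping cone over the
    Koszul complex of the variables generating the colon ideal. *)
Lemma minimal_betti_linear_quotients (T : eqType) (L : seq T)
    (mu : T -> 'X_{1..n}) (Y : T -> seq 'I_n) :
  (forall L1 x L2, L = L1 ++ x :: L2 ->
     [/\ uniq (Y x), (forall y, y \in L1 -> mdeg (mu y) <= mdeg (mu x))%N
       & forall v, has (fun y => mu y <= v + mu x)%MM L1 =
                   has (fun y => 0 < v y)%N (Y x)]) ->
  minimal_betti (@monomial_ideal K n (fun u => u \in [seq mu x | x <- L]))
    (fun i j => \sum_(x <- L) (j == (mdeg (mu x) + i)%N%:Z) * 'C(size (Y x), i))%N.
Proof.
elim/last_ind: L => [|L x IHL] hL.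
  by apply: minimal_betti_ext minimal_betti_nil => // i j; rewrite big_nil.
have [|uY degx colx] := hL L x [::]; first by rewrite cats1.
have {IHL}bL := IHL _.
have bY := minimal_betti_variables uY.
have {}bL := minimal_betti_cone (w := mu x) _ _ _ _ (bL _) bY.
pose I' := monomial_ideal (K := K) (fun u => u \in [seq mu z | z <- rcons L x]).
apply: minimal_betti_ext (bL I' _ _ _ _ _) => //.
- move=> i j; rewrite big_rcons /=; congr (_ + _)%N.
  case: i => [|i]; first by rewrite bin0 muln1 addn0.
  by rewrite subr_eq addnC PoszD.
- move=> a; apply: monomial_ideal_colon => u; split.
    case=> _ /mapP[y yY ->]; rewrite lep1mP => uy.
    have /hasP[z zL le] : has (fun z => mu z <= u + mu x)%MM L.
      by rewrite colx; apply/hasP; exists y; rewrite // lt0n.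
    by exists (mu z); rewrite ?map_f.
  case=> _ /mapP[z zL ->] le.
  have /hasP[y yY uy] : has (fun y => 0 < u y)%N (Y x).
    by rewrite -colx; apply/hasP; exists z.
  by exists U_(y)%MM; rewrite ?map_f // lep1mP -lt0n.
- by move=> p; rewrite /I' map_rcons; apply: monomial_ideal_rcons.
- move=> i j; rewrite sum_nat_seq_neq0 => /hasP[y /degx le].
  by case: (j =P _) => [-> _|]; rewrite ?mul0n //; lia.
- by move=> i j; case: (j =P _) => [->|]; rewrite ?mul0n.
- move=> L1 y L2 e; apply: (hL L1 y (rcons L2 x)).
  by rewrite e rcons_cat.
Qed.

End LinearQuotients.

(** * Monomials as sorted words *)

Section Words.

Variable m : nat.
Implicit Types (s e f : seq 'I_m) (u v : 'X_{1..m}).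

(** Sorted words over the variables encode monomials.  Divisibility and the
    exchange of variables become prefixes and letterwise comparison of words. *)
Definition mon s : 'X_{1..m} := (\sum_(i <- s) U_(i))%MM.

Definition word u : seq 'I_m := flatten [seq nseq (u i) i | i <- enum 'I_m].

Definition wsorted s := sorted (fun i j : 'I_m => (i <= j)%N) s.

Definition letter s l := nth 0%N (map val s) l.

Lemma wordK : cancel word mon.
Proof.
move=> u; rewrite /mon /word big_flatten big_map /= {2}(multinomUE_id u).
rewrite big_enum; apply: eq_bigr => i _.
by elim: (u i) => [|k IHk]; rewrite ?big_nil ?mulm0n //= big_cons IHk mulmS.
Qed.

Lemma monE s i : mon s i = count_mem i s.
Proof.
rewrite /mon mnm_sumE -sum1_count [RHS]big_mkcond /=.
by apply: eq_bigr => k _; rewrite mnm1E; case: (k == i).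
Qed.

Lemma mdeg_mon s : mdeg (mon s) = size s.
Proof.
by rewrite /mon mdeg_sum (eq_bigr (fun=> 1%N)) ?sum1_size // => i _; apply: mdeg1.
Qed.

Lemma size_word u : size (word u) = mdeg u.
Proof. by rewrite -mdeg_mon wordK. Qed.

Lemma word_sorted u : wsorted (word u).
Proof.
rewrite /wsorted sorted_pairwise; last by move=> i j k; apply: leq_trans.
have : pairwise (fun i j : 'I_m => (i < j)%N) (enum 'I_m).
  rewrite -sorted_pairwise; last by move=> i j k; apply: ltn_trans.
  by have := iota_ltn_sorted 0 m; rewrite -val_enum_ord sorted_map.
rewrite /word; elim: (enum 'I_m) => //= i s IHs /andP[/allP lt_i /IHs ps].
rewrite pairwise_cat ps andbT; apply/andP; split.
  apply/allrelP => a b; rewrite mem_nseq => /andP[_ /eqP->].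
  by case/flatten_mapP => c /lt_i ic; rewrite mem_nseq => /andP[_ /eqP->]; apply: ltnW.
elim: (u i) => //= k ->; rewrite andbT; apply/allP => b.
by rewrite mem_nseq => /andP[_ /eqP->].
Qed.

Lemma monK s : wsorted s -> word (mon s) = s.
Proof.
move=> ss; apply: (sorted_eq _ _ (word_sorted _) ss).
- by move=> i j k; apply: leq_trans.
- by move=> i j ij; apply/val_inj/eqP; rewrite eqn_leq.
by apply/allP => i _ /=; rewrite -monE wordK monE.
Qed.

Lemma mon_cons i s : mon (i :: s) = (U_(i) + mon s)%MM.
Proof. by rewrite /mon big_cons. Qed.

Lemma mon_cat s1 s2 : mon (s1 ++ s2) = (mon s1 + mon s2)%MM.
Proof. by rewrite /mon big_cat. Qed.

Lemma mon_take_le r s : (mon (take r s) <= mon s)%MM.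
Proof. by rewrite -{2}(cat_take_drop r s) mon_cat lem_addr. Qed.

Lemma mon_rem i s : i \in s -> mon (rem i s) = (mon s - U_(i))%MM.
Proof.
move=> i_s; suff -> : mon s = (U_(i) + mon (rem i s))%MM by rewrite addmC addmK.
by rewrite -mon_cons /mon (perm_big _ (perm_to_rem i_s)).
Qed.

Lemma wsorted_take r s : wsorted s -> wsorted (take r s).
Proof. exact: take_sorted. Qed.

Lemma letter_nth x s l : (l < size s)%N -> letter s l = nth x s l.
Proof. by move=> ls; rewrite /letter (nth_map x). Qed.

Lemma letter_mono s k l : wsorted s -> (k <= l)%N -> (l < size s)%N ->
  (letter s k <= letter s l)%N.
Proof.
move=> ss kl ls; rewrite /letter.
apply: (sorted_leq_nth leq_trans leqnn); rewrite ?inE ?size_map //.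
  by rewrite sorted_map.
exact: leq_ltn_trans ls.
Qed.

Lemma letter_lt s l : (l < size s)%N -> (letter s l < m)%N.
Proof. by case: s => // x s ls; rewrite (letter_nth x). Qed.

Lemma letter_take r s l : (l < r)%N -> letter (take r s) l = letter s l.
Proof. by move=> lr; rewrite /letter map_take nth_take. Qed.

Lemma letter_set x0 s q x l : (q < size s)%N ->
  letter (set_nth x0 s q x) l = if l == q then val x else letter s l.
Proof.
elim: s q l => [|y s IHs] [|q] [|l] //= qs; rewrite /letter /= in IHs *.
exact: IHs.
Qed.

Lemma wsortedP s :
  (forall l, (l.+1 < size s)%N -> (letter s l <= letter s l.+1)%N) -> wsorted s.
Proof.
move=> h; case: s h => // x s h; apply/(sortedP x) => l ls.
by have := h l ls; rewrite !(letter_nth x) // ltnW.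
Qed.

Lemma letter_rem s i l : wsorted s -> (l < (size s).-1)%N ->
  (letter s l <= letter (rem i s) l)%N.
Proof.
elim: s l => // x s IHs l ss ls /=; case: ifP => _.
  exact: (@letter_mono (x :: s) l l.+1).
case: l ls => [|l] ls //; apply: (IHs l (path_sorted ss)).
by move: ls => /=; case: (s).
Qed.

Lemma max_index_mon s : wsorted s -> (0 < size s)%N ->
  (max_index (mon s)).-1 = letter s (size s).-1.
Proof.
move=> ss s0; have ls : ((size s).-1 < size s)%N by rewrite prednK.
suff -> : max_index (mon s) = (letter s (size s).-1).+1 by [].
apply/eqP; rewrite eqn_leq; apply/andP; split.
  apply/bigmax_leqP => i; rewrite monE -has_count has_pred1 => /(nthP i)[l lts <-].
  by rewrite -letter_nth // ltnS letter_mono // -ltnS prednK.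
case: s ss s0 ls => // x s ss s0 ls; rewrite (letter_nth x) //.
by apply: leq_bigmax_cond; rewrite monE -has_count has_pred1 mem_nth.
Qed.

Lemma sum_letters s s' : size s = size s' ->
  (forall l, (l < size s)%N -> (letter s l <= letter s' l)%N) ->
  (sumn (map val s) <= sumn (map val s'))%N /\
  ((sumn (map val s') <= sumn (map val s))%N -> s = s').
Proof.
elim: s s' => [|x s IHs] [|x' s'] //= [es] h.
have xx : (x <= x')%N by apply: (h 0%N).
have [|le eqs] := IHs s' es; first by move=> l ls; apply: (h l.+1).
split=> [|ge]; first exact: leq_add.
have xE : x = x'.
  apply/val_inj/eqP; rewrite eqn_leq xx -(leq_add2r (sumn (map val s))).
  by apply: leq_trans ge; rewrite leq_add2l.
by rewrite eqs ?xE //; move: ge; rewrite xE leq_add2l.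
Qed.

Definition weight u : nat := (\sum_(i < m) u i * i)%N.

Lemma weight_mon s : weight (mon s) = sumn (map val s).
Proof.
rewrite /weight; elim: s => [|x s IHs].
  by rewrite big1 // => i _; rewrite monE mul0n.
rewrite /= -IHs (eq_bigr (fun i : 'I_m => (x == i) * i + mon s i * i)%N); last first.
  by move=> i _; rewrite mon_cons mnmDE mnm1E mulnDl.
rewrite big_split /= (bigD1 x) //= eqxx mul1n big1 ?addn0 // => i.
by rewrite eq_sym => /negbTE->.
Qed.

End Words.

(** In a sorted list the entries at most [k] are the first ones. *)
Lemma count_sorted (r : seq nat) k l : sorted leq r -> (l < size r)%N ->
  (l < count (fun i => i <= k) r)%N = (nth 0 r l <= k)%N.
Proof.
elim: r l => // x r IHr l /= sr lr; have sr' := path_sorted sr.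
have [xk|kx] := leqP x k; first by case: l lr => [|l] lr //; rewrite add1n ltnS IHr.
have xr := order_path_min leq_trans sr.
rewrite add0n (_ : count _ _ = 0%N); last first.
  apply/eqP; rewrite -leqn0 leqNgt -has_count; apply/hasPn => y /(allP xr) xy.
  by rewrite -ltnNge (leq_trans kx).
apply/esym/negbTE; rewrite -ltnNge; case: l lr => // l lr /=.
by rewrite (leq_trans kx) // (allP xr) // mem_nth.
Qed.

(** * Stretched words and the facets of squeezed complexes *)

Section StretchedWords.

Variables (m t : nat).
Implicit Types (s e f : seq 'I_m) (u v : 'X_{1..m}).

(** Consecutive letters are pushed apart by 2 up to position [t], and by 1
    afterwards.  The places of a minimal generator of [I(U)] form a nonface; for
    a word [s] of an element of [U], its places, the successors of the first [t] of
    them and a final segment make up the facet.  The two cases in the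
    definition of the facets are merged by [minn]. *)
Definition place s l := (letter s l + l + minn l t)%N.

Definition places s := mkseq (place s) (size s).

Definition covered s c :=
  has (fun l => (c == place s l) || ((l < t)%N && (c == (place s l).+1)))
      (iota 0 (size s)).

Definition tail_start s := (m + size s + minn (size s) t)%N.

Lemma coveredP s c :
  reflect (exists2 l, (l < size s)%N & c = place s l \/ (l < t)%N /\ c = (place s l).+1)
          (covered s c).
Proof.
apply: (iffP hasP) => [[l]|[l ls cl]].
  rewrite mem_iota => /andP[_ ls] /orP[/eqP->|/andP[lt /eqP->]]; exists l => //.
    by left.
  by right.
exists l; first by rewrite mem_iota.
by case: cl => [->|[-> ->]]; rewrite eqxx ?orbT.
Qed.

Lemma place_lt s k l : wsorted s -> (k < l)%N -> (l < size s)%N ->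
  (place s k + (k < t) < place s l)%N.
Proof.
move=> ss kl ls; have := letter_mono ss (ltnW kl) ls; rewrite /place; lia.
Qed.

Lemma places_uniq s : wsorted s -> uniq (places s).
Proof.
move=> ss; apply/mkseq_uniqP => k l; rewrite !inE => ks ls e.
by case: (ltngtP k l) => // [/(place_lt ss)/(_ ls)|/(place_lt ss)/(_ ks)]; lia.
Qed.

Lemma mem_placesP s c :
  reflect (exists2 l, (l < size s)%N & c = place s l) (c \in places s).
Proof.
apply: (iffP mapP) => -[l]; first by rewrite mem_iota => ?; exists l.
by exists l; rewrite ?mem_iota.
Qed.

Lemma indicesE u : indices u = [seq (val i).+1 | i <- word u].
Proof.
rewrite /indices /word; elim: (enum 'I_m) => //= i r IHr.
by rewrite map_cat map_nseq IHr.
Qed.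

Lemma mem_facet (U : {fset 'X_{1..m}}) u (c : 'I_(m + t + dmax U)) :
  (c \in facet U t u) = covered (word u) c || (tail_start (word u) <= c)%N.
Proof.
rewrite inE /in_facet /tail_start -size_word indicesE.
have idx l : (l < size (word u))%N ->
    nth 0%N [seq (val i).+1 | i <- word u] l = (letter (word u) l).+1.
  by move=> ls; rewrite (map_comp S val) (nth_map 0%N) ?size_map.
have cN := ltn_ord c; set s := word u in idx *.
case: ifP => st; apply/idP/idP.
- case/orP=> [/hasP[l]|]; last by move=> h; apply/orP; right; lia.
  rewrite mem_index_iota => /andP[l1 ls]; have ls' : (l.-1 < size s)%N by lia.
  rewrite idx // => h; apply/orP; left; apply/coveredP; exists l.-1 => //.
  by rewrite /place; lia.
- case/orP=> [/coveredP[l ls h]|]; last by move=> h; apply/orP; right; lia.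
  apply/orP; left; apply/hasP; exists l.+1; first by rewrite mem_index_iota.
  by rewrite /= idx //; move: h; rewrite /place; lia.
- case/orP=> [/hasP[l]|/orP[/hasP[l]|]].
  + rewrite mem_index_iota => /andP[l1 ls]; have ls' : (l.-1 < size s)%N by lia.
    rewrite idx // => h; apply/orP; left; apply/coveredP; exists l.-1 => //.
    by rewrite /place; lia.
  + rewrite mem_index_iota => /andP[l1 ls]; have ls' : (l.-1 < size s)%N by lia.
    rewrite idx // => h; apply/orP; left; apply/coveredP; exists l.-1 => //.
    by rewrite /place; lia.
  by move=> h; apply/orP; right; lia.
case/orP=> [/coveredP[l ls h]|]; last by move=> h; rewrite !orbA; apply/orP; right; lia.
have [lt|tl] := ltnP l t.
  apply/orP; left; apply/hasP; exists l.+1; first by rewrite mem_index_iota; lia.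
  by rewrite /= idx //; move: h; rewrite /place; lia.
apply/orP; right; apply/orP; left; apply/hasP; exists l.+1.
  by rewrite mem_index_iota; lia.
by rewrite /= idx //; move: h; rewrite /place; lia.
Qed.

(** Call a block of [e] one of its places, together with the successor if the
    facet has it.  By induction on [l], place [l] of [f] is too small to lie in
    the tail, and as it is too far from place [l - 1] to share its block, it lies
    in a block of index at least [l]. *)
Lemma places_in_facet e f : wsorted e -> wsorted f ->
  (forall l, (l < size f)%N ->
     covered e (place f l) || (tail_start e <= place f l)%N) ->
  forall l, (l < size f)%N -> (l < size e)%N /\ (letter e l <= letter f l)%N.
Proof.
move=> se sf h; elim=> [|l IHl] lf; have fm := letter_lt lf.
  case/orP: (h _ lf) => [/coveredP[k ke pk]|]; last by rewrite /tail_start /place; lia.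
  have := letter_mono se (leq0n k) ke; split; first by lia.
  move: pk; rewrite /place; lia.
have [le le_l] := IHl (ltnW lf).
have := place_lt sf (ltnSn l) lf => pf.
case/orP: (h _ lf) => [/coveredP[k ke pk]|]; last by rewrite /tail_start /place; lia.
have lk : (l < k)%N.
  rewrite ltnNge leq_eqVlt; apply/negP => /orP[/eqP kl|kl].
    by move: pk pf; rewrite kl /place; lia.
  by move: (place_lt se kl le) pk pf; rewrite /place; lia.
have := letter_mono se lk ke; split; first by lia.
move: pk; rewrite /place; lia.
Qed.

(** Greedy covering: starting from the word [s] already read off, the least
    element of [A] that is not covered yet is the next place, unless it lies in
    the tail. *)
Lemma greedy_cover (N : nat) (A : pred nat) : (forall c, A c -> (c < N)%N) ->
  exists s, [/\ wsorted s, all A (places s)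
    & forall c, A c -> covered s c || (tail_start s <= c)%N].
Proof.
move=> AN.
(* The least number beyond the last block of [s]. *)
pose next s := if size s is l.+1 then (place s l + (l < t)).+1 else 0%N.
suff main k : forall s, (N - next s <= k)%N -> wsorted s -> all A (places s) ->
    (forall c, A c -> (c < next s)%N -> covered s c) ->
  exists s, [/\ wsorted s, all A (places s)
    & forall c, A c -> covered s c || (tail_start s <= c)%N].
  by apply: (main N [::]) => //; rewrite leq_subr.
elim: k => [|k IHk] s Nk ss As cov.
  exists s; split=> // c Ac.
  by rewrite cov // (leq_trans (AN c Ac)) -?subn_eq0 -?leqn0.
pose p c := [&& A c, (next s <= c)%N & ~~ (tail_start s <= c)%N].
case: (boolP (has p (iota 0 N))); last first.
  move=> /hasPn hN; exists s; split=> // c Ac.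
  have [/(cov _ Ac)-> //|nc] := ltnP c (next s).
  by have := hN c; rewrite mem_iota AN // /p Ac nc /= negbK => -> //; apply: orbT.
case/hasP=> c0 _ pc0; have exp : exists c, p c by exists c0.
have [c /and3P[Ac nc tc] cmin] := ex_minnP exp.
pose L := size s; have Lc : (L + minn L t <= c)%N.
  move: nc; rewrite /next -/L; case: L => [|l] //=; rewrite /place; lia.
have xm : (c - L - minn L t < m)%N.
  by move: tc; rewrite /tail_start -/L; lia.
pose s' := rcons s (Ordinal xm).
have letters l : (l < L)%N -> letter s' l = letter s l.
  by move=> lL; rewrite /letter map_rcons nth_rcons size_map lL.
have letterL : letter s' L = (c - L - minn L t)%N.
  by rewrite /letter map_rcons nth_rcons size_map ltnn eqxx.
have place_s l : (l < L)%N -> place s' l = place s l.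
  by move=> lL; rewrite /place letters.
have placeL : place s' L = c by rewrite /place letterL; lia.
have size_s' : size s' = L.+1 by rewrite size_rcons.
have nextS : next s' = (c + (L < t)).+1 by rewrite /next size_s' placeL.
apply: (IHk s').
- by have := AN c Ac; move: Nk nc; rewrite nextS; lia.
- apply: wsortedP => l; rewrite size_s' ltnS => lL.
  rewrite letters //; have [lL'|] := ltnP l.+1 L.
    by rewrite letters // letter_mono.
  move=> Ll; have lE : L = l.+1 by lia.
  rewrite -lE letterL; move: nc; rewrite /next -/L lE /place; lia.
- apply/allP => a /mem_placesP[l]; rewrite size_s' ltnS leq_eqVlt => /orP[/eqP->|lL] ->.
    by rewrite placeL.
  by rewrite place_s //; apply: (allP As); apply/mem_placesP; exists l.
move=> a Aa; rewrite nextS => ac; apply/coveredP.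
have [an|na] := ltnP a (next s).
  have /coveredP[l lL al] := cov a Aa an; exists l; first by rewrite size_s' ltnW.
  by rewrite place_s.
exists L; first by rewrite size_s'.
rewrite placeL; have [ca|ca] := ltnP c a; first by right; lia.
left; apply/eqP; rewrite eqn_leq ca; apply: cmin; rewrite /p Aa na.
by rewrite -ltnNge (leq_ltn_trans ca) // ltnNge.
Qed.

End StretchedWords.

(** * Squarefree monomials *)

Section SquareFreeMonomials.

Variable N : nat.
Implicit Types (A B : {set 'I_N}) (u : 'X_{1..N}).

Definition set_mon A : 'X_{1..N} := [multinom (i \in A : nat) | i < N].

Lemma set_mon_leP A u : reflect (forall i, i \in A -> (0 < u i)%N) (set_mon A <= u)%MM.
Proof.
apply: (iffP mnm_lepP) => h i; first by move=> iA; have := h i; rewrite mnmE iA.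
by rewrite mnmE; case: (boolP (i \in A)) => [/h|].
Qed.

Lemma mdeg_set_mon A : mdeg (set_mon A) = #|A|.
Proof.
rewrite mdegE -sum1_card [RHS]big_mkcond /=.
by apply: eq_bigr => i _; rewrite mnmE; case: (i \in A).
Qed.

Lemma set_monX (K : fieldType) A :
  \prod_(i in A) 'X_i = 'X_[set_mon A] :> {mpoly K[N]}.
Proof.
rewrite mpolyXE_id big_mkcond /=; apply: eq_bigr => i _.
by rewrite mnmE; case: (i \in A).
Qed.

Lemma card_set_seq (r : seq nat) : uniq r -> all (fun c => c < N)%N r ->
  #|[set c : 'I_N | val c \in r]| = size r.
Proof.
move=> ur rN; rewrite cardE -(size_map val).
apply/perm_size/uniq_perm => //; first by rewrite (map_inj_uniq val_inj) enum_uniq.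
move=> c; apply/mapP/idP => [[i]|cr]; first by rewrite mem_enum inE => ir ->.
by exists (Ordinal (allP rN c cr)); rewrite // mem_enum inE.
Qed.

End SquareFreeMonomials.

(** * Minimal generators of the complement of a shifted order ideal *)

Section Generators.

Variables (K : fieldType) (m : nat) (U : {fset 'X_{1..m}}).
Hypotheses (hU : order_ideal U) (hs : shifted U).
Variable G : {fset 'X_{1..m}}.
Hypothesis hG : minimal_monomial_generators (ideal_of K U) G.
Implicit Types (s e f : seq 'I_m) (u v : 'X_{1..m}).

Lemma order_ideal_le u v : u \in U -> (v <= u)%MM -> v \in U.
Proof. by case: hU => h _ _; apply: h. Qed.

(** Letters can be raised one at a time. *)
Lemma order_ideal_letters s s' : size s = size s' ->
  (forall l, (l < size s)%N -> (letter s l <= letter s' l)%N) ->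
  mon s \in U -> mon s' \in U.
Proof.
rewrite -[mon s]add0m -[mon s']add0m.
elim: s s' (0%MM) => [|x s IHs] [|x' s'] v //= [es] h.
rewrite !mon_cons !addmA; move: (h 0%N isT) => xx' vsU.
apply: (IHs s' _ es) => [l ls|]; first exact: (h l.+1).
have [xE|] := eqVneq x x'; first by rewrite -xE.
have swap y : (v + U_(y) + mon s)%MM = (U_(y) + (v + mon s))%MM.
  by rewrite (addmC v) addmA.
rewrite -val_eqE => nx; rewrite swap; apply: (hs (i := x)); last by rewrite -swap.
by rewrite ltn_neqAle nx.
Qed.

Lemma gen_notin u : u \in G -> u \notin U.
Proof.
case: hG => gen _ uG; apply/negP => uU.
have /gen/monomial_ideal_msupp :
    monomial_ideal (fun v => v \in G) ('X_[u] : {mpoly K[m]}).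
  exact: (@monomial_idealX K m _ u u uG (lepm_refl u)).
case/(_ u); first by rewrite msuppX mem_seq1.
by move=> v /negP vU vu; apply/vU/(order_ideal_le uU).
Qed.

Lemma gen_below u : u \notin U -> exists2 v, v \in G & (v <= u)%MM.
Proof.
case: hG => gen _ uU.
have /gen/monomial_ideal_msupp : ideal_of K U ('X_[u] : {mpoly K[m]}).
  exact: (@monomial_idealX K m _ u u uU (lepm_refl u)).
by apply; rewrite msuppX mem_seq1.
Qed.

Lemma mnm_le_anti u v : (u <= v)%MM -> (v <= u)%MM -> u = v.
Proof.
move=> /mnm_lepP uv /mnm_lepP vu; apply/mnmP => i; apply/eqP.
by rewrite eqn_leq uv vu.
Qed.

Lemma mnm_lt_ex u v : (v <= u)%MM -> v != u ->
  exists i, (U_(i) <= u)%MM /\ (v <= u - U_(i))%MM.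
Proof.
move=> /mnm_lepP vu; case: (boolP [exists i, (v i < u i)%N]) => [/existsP[i vi] _|].
  exists i; split; first by rewrite lep1mP -lt0n (leq_ltn_trans _ vi).
  apply/mnm_lepP => k; rewrite mnmBE mnm1E; case: (i =P k) => [<-|_].
    by rewrite subn1 -ltnS prednK // (leq_ltn_trans _ vi).
  by rewrite subn0.
rewrite negb_exists => /forallP h /eqP[]; apply/mnmP => i; apply/eqP.
by rewrite eqn_leq vu leqNgt h.
Qed.

Lemma gen_intro u : u \notin U ->
  (forall i, (U_(i) <= u)%MM -> (u - U_(i))%MM \in U) -> u \in G.
Proof.
move=> uU h; have [v vG vu] := gen_below uU; have [<- //|nvu] := eqVneq v u.
have [i [iu vi]] := mnm_lt_ex vu nvu.
by have := gen_notin vG; rewrite (order_ideal_le (h i iu) vi).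
Qed.

Lemma gen_minimal u v : u \in G -> v \notin U -> (v <= u)%MM -> v = u.
Proof.
move=> uG vU vu; have [//|nvu] := eqVneq v u.
have [w wG wv] := gen_below vU; have wu := lepm_trans wv vu.
have nwu : w != u.
  by apply: contraNneq nvu => wE; apply/eqP/mnm_le_anti => //; rewrite -wE.
case: hG => gen /(_ (G `\ u)%fset) []; first by rewrite fproperD1.
move=> p; rewrite gen; apply: eq_monomial_ideal => a; split=> -[b bG ba]; last first.
  by exists b => //; move: bG; rewrite in_fsetD1 => /andP[].
have [bu|nbu] := eqVneq b u; last by exists b; rewrite // in_fsetD1 nbu.
by exists w; rewrite ?in_fsetD1 ?nwu // (lepm_trans wu) // -bu.
Qed.

Lemma gen_degree u : u \in G -> (0 < mdeg u <= (dmax U).+1)%N.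
Proof.
move=> uG; have uU := gen_notin uG.
have u0 : 0%MM != u by apply: contraNneq uU => <-; case: hU.
have [i [iu _]] : exists i, (U_(i) <= u)%MM /\ (0 <= u - U_(i))%MM.
  by apply: mnm_lt_ex u0; apply/mnm_lepP => i; rewrite mnm0E.
have du : mdeg u = (mdeg (u - U_(i))%MM).+1 by rewrite -{1}(submK iu) mdegD mdeg1 addn1.
rewrite du /= ltnS; apply: leq_bigmax_seq => //.
have [//|vU] := boolP ((u - U_(i))%MM \in U).
have := gen_minimal uG vU (lem_subr _ _) => vE.
by move: du; rewrite vE => /eqP; rewrite -[X in X == _]addn0 -addn1 eqn_add2l.
Qed.

(** For a strongly stable ideal, the shortest prefix of a sorted word lying in
    the ideal is a minimal generator: deleting any letter leaves a word that
    dominates the next shorter prefix letter by letter. *)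
Lemma gen_prefix s : wsorted s -> mon s \notin U -> exists r, mon (take r s) \in G.
Proof.
move=> ss sU; have ex : exists r, mon (take r s) \notin U.
  by exists (size s); rewrite take_size.
have [r rU rmin] := ex_minnP ex; exists r; apply: gen_intro => // i.
have rs : (r <= size s)%N by apply: rmin; rewrite take_size.
have sr : wsorted (take r s) by apply: wsorted_take.
rewrite lep1mP monE -lt0n -has_count has_pred1 => ir; rewrite -mon_rem //.
have r0 : (0 < r)%N by case: (r) ir => //; rewrite take0.
have r1U : mon (take r.-1 s) \in U.
  by apply: contraT => /rmin; rewrite leqNgt prednK // leqnn.
have sz : size (take r s) = r by rewrite size_takel.
apply: order_ideal_letters r1U.
  by rewrite size_rem // sz size_takel // (leq_trans (leq_pred _)).
move=> l; rewrite size_takel ?(leq_trans (leq_pred _)) // => lr.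
rewrite letter_take // -(@letter_take _ r) ?(leq_trans lr) ?leq_pred //.
by apply: letter_rem => //; rewrite sz.
Qed.

End Generators.

(** * Linear quotients of the Stanley-Reisner ideal *)

Section ColonPlaces.

Variables (m t : nat).
Implicit Types (e f : seq 'I_m).

(** Let [e] be the word of a generator.  For [k] less than its last letter,
    replacing the first letter greater than [k], in position [q], by [k] gives the
    word of another monomial of the ideal, by strong stability.  Its
    stretched word differs from that of [e] in the place [k + q + minn q t] only,
    so the variable at this place lies in the colon ideal of the earlier generators. *)
Definition colon_places e :=
  [seq (let q := count (fun i => i <= k)%N (map val e) in k + q + minn q t)%N
     | k <- iota 0 (letter e (size e).-1)].

Lemma place_take r e l : (l < r)%N -> place t (take r e) l = place t e l.
Proof. by move=> lr; rewrite /place letter_take. Qed.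

Lemma count_letters e k l : wsorted e -> (l < size e)%N ->
  (l < count (fun i => i <= k) (map val e))%N = (letter e l <= k)%N.
Proof.
by move=> se le; rewrite count_sorted ?size_map // sorted_map.
Qed.

Lemma colon_placesP e c : wsorted e ->
  reflect (exists q k, [/\ (q < size e)%N, (k < letter e q)%N,
             (0 < q)%N -> (letter e q.-1 <= k)%N & c = (k + q + minn q t)%N])
          (c \in colon_places e).
Proof.
move=> se; apply: (iffP mapP) => [[k]|[q [k [qe kq qk ->]]]].
  rewrite mem_iota add0n /= => ke ->; set q := count _ _; exists q, k.
  have e0 : (0 < size e)%N by case: (e) ke.
  have el : ((size e).-1 < size e)%N by rewrite prednK.
  have qe : (q < size e)%N.
    by have := count_letters k se el; rewrite -/q [in RHS]leqNgt ke /=; lia.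
  split=> //; first by rewrite ltnNge -count_letters // -/q ltnn.
  by move=> q0; rewrite -count_letters ?prednK // ltnW.
exists k.
  by rewrite mem_iota /= add0n (leq_trans kq) // letter_mono //; lia.
suff -> : count (fun i => i <= k)%N (map val e) = q by [].
apply/eqP; rewrite eqn_leq leqNgt count_letters // -ltnNge kq /=.
case: (posnP q) => [-> //|q0].
have := count_letters k se (leq_ltn_trans (leq_pred q) qe).
by rewrite qk // prednK.
Qed.

Lemma size_colon_places e : size (colon_places e) = letter e (size e).-1.
Proof. by rewrite size_map size_iota. Qed.

Lemma colon_places_uniq e : uniq (colon_places e).
Proof.
pose q k := count (fun i => i <= k)%N (map val e).
have mono k l : (k <= l)%N -> (q k <= q l)%N.
  by move=> kl; apply: sub_count => i /= /leq_trans; apply.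
rewrite map_inj_in_uniq ?iota_uniq // => k l _ _ /=; rewrite -/(q k) -/(q l).
by case: (ltngtP k l) => // kl; have := mono _ _ (ltnW kl); lia.
Qed.

Lemma colon_places_lt e c : wsorted e -> c \in colon_places e ->
  exists2 q, (q < size e)%N & (c < place t e q)%N.
Proof.
move=> se /(colon_placesP _ se)[q [k [qe kq _ ->]]]; exists q => //.
by rewrite /place !ltn_add2r.
Qed.

(** The place obtained from [k] lies strictly between two consecutive places of
    [e], or before the first one. *)
Lemma colon_places_notin e c : wsorted e -> c \in colon_places e -> c \notin places t e.
Proof.
move=> se /(colon_placesP _ se)[q [k [qe kq qk ->]]].
apply/negP => /mem_placesP[l le].
have [ql|lq] := leqP q l.
  by have := letter_mono se ql le; rewrite /place; lia.
have := letter_mono se (_ : l <= q.-1)%N (_ : q.-1 < size e)%N.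
by have := qk (leq_ltn_trans (leq0n _) lq); rewrite /place; lia.
Qed.

End ColonPlaces.

Section StretchedIdeal.

Variables (K : fieldType) (m t : nat) (U : {fset 'X_{1..m}}).
Hypotheses (hU : order_ideal U) (hs : shifted U).
Variable G : {fset 'X_{1..m}}.
Hypothesis hG : minimal_monomial_generators (ideal_of K U) G.
Implicit Types (e f s : seq 'I_m) (u v x y : 'X_{1..m}).

Local Notation N := (m + t + dmax U)%N.

Definition stretch u : {set 'I_N} := [set c | val c \in places t (word u)].

Definition colon_vars u : seq 'I_N :=
  enum [set c : 'I_N | val c \in colon_places t (word u)].

Lemma place_bound u l : u \in G -> (l < size (word u))%N -> (place t (word u) l < N)%N.
Proof.
move=> uG lu; have := gen_degree hU hG uG; rewrite -size_word => /andP[_ du].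
have := letter_lt lu; rewrite /place; lia.
Qed.

Lemma mdeg_stretch u : u \in G -> mdeg (set_mon (stretch u)) = mdeg u.
Proof.
move=> uG; rewrite mdeg_set_mon card_set_seq ?places_uniq ?word_sorted //.
  by rewrite size_mkseq size_word.
by apply/allP => _ /mem_placesP[l lu ->]; apply: place_bound.
Qed.

Lemma size_colon_vars u : u \in G -> size (colon_vars u) = (max_index u).-1.
Proof.
move=> uG; rewrite -cardE card_set_seq ?colon_places_uniq //.
  rewrite size_colon_places -[in RHS](wordK u) max_index_mon ?word_sorted //.
  by rewrite size_word; have /andP[] := gen_degree hU hG uG.
apply/allP => c /(colon_places_lt (word_sorted u))[q qu cq].
exact: ltn_trans cq (place_bound uG qu).
Qed.

(** If the facet of some [v] in [U] contained the places of [u], the word of [u]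
    would dominate a prefix of the word of [v], and [u] would lie in [U]. *)
Lemma stretch_nonface u : u \in G -> stretch u \notin squeezed_complex U t.
Proof.
move=> uG; rewrite inE; apply/hasPn => v vU; apply/negP => /subsetP sub.
have dom := places_in_facet (word_sorted v) (word_sorted u) (t := t).
have {}dom l : (l < size (word u))%N ->
    (l < size (word v))%N /\ (letter (word v) l <= letter (word u) l)%N.
  apply: dom => {}l lu; have := sub (Ordinal (place_bound uG lu)).
  by rewrite mem_facet; apply; rewrite inE; apply/mem_placesP; exists l.
have /negP[] := gen_notin hU hG uG; rewrite -(wordK u).
have le : (size (word u) <= size (word v))%N.
  case: (posnP (size (word u))) => [->|u0] //.
  by rewrite -(prednK u0) (dom _ _).1 // prednK.
apply: (order_ideal_letters hs (s := take (size (word u)) (word v))).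
- by rewrite size_takel.
- by move=> l; rewrite size_takel // => lu; rewrite letter_take // (dom l lu).2.
by apply: (order_ideal_le hU) (mon_take_le _ _); rewrite wordK.
Qed.

(** The greedy word whose places lie in [A] does not give an element of [U], for
    its facet would contain [A]; so it has a prefix that is a generator. *)
Lemma nonface_stretch (A : {set 'I_N}) : A \notin squeezed_complex U t ->
  exists2 u, u \in G & stretch u \subset A.
Proof.
move=> AD; pose a c := [exists i : 'I_N, (i \in A) && (val i == c)].
have aN c : a c -> (c < N)%N by case/existsP=> i /andP[_ /eqP<-]; apply: ltn_ord.
have [s [ss As cov]] := greedy_cover m t aN.
have sU : mon s \notin U.
  apply: contra AD => sU; rewrite inE; apply/hasP; exists (mon s) => //.
  apply/subsetP => c cA; rewrite mem_facet monK //; apply: cov.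
  by apply/existsP; exists c; rewrite cA eqxx.
have [r rG] := gen_prefix hU hs hG ss sU; exists (mon (take r s)) => //.
apply/subsetP => c; rewrite inE monK ?wsorted_take // => /mem_placesP[l lr cE].
have lr' : (l < r)%N /\ (l < size s)%N by move: lr; rewrite size_take_min; lia.
have /existsP[i /andP[iA /eqP ic]] : a (val c).
  rewrite cE place_take ?lr'.1 //; apply: (allP As); apply/mem_placesP.
  by exists l; rewrite ?lr'.2.
by rewrite (val_inj (esym ic) : c = i).
Qed.

Lemma stanley_reisner_stretch (L : seq 'X_{1..m}) : L =i G -> forall p,
  stanley_reisner K (squeezed_complex U t) p <->
  monomial_ideal (fun w => w \in [seq set_mon (stretch u) | u <- L]) p.
Proof.
move=> LG p.
transitivity (monomial_ideal (fun w => exists2 A : {set 'I_N},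
    A \notin squeezed_complex U t & w = set_mon A) p).
  split=> -[s [Ss ->]]; exists s; split=> // c /Ss.
    by case=> A AD ->; exists (set_mon A); [exists A|rewrite set_monX].
  by case=> v [A AD ->] ->; exists A; rewrite ?set_monX.
apply: eq_monomial_ideal => v; split=> -[w]; last first.
  case/mapP=> u; rewrite LG => uG -> uv.
  by exists (set_mon (stretch u)); first by exists (stretch u); rewrite ?stretch_nonface.
case=> A /nonface_stretch[u uG /subsetP uA] -> /set_mon_leP Av.
exists (set_mon (stretch u)); first by apply/mapP; exists u; rewrite ?LG.
by apply/set_mon_leP => i /uA/Av.
Qed.

(** The order of the generators along which quotients are linear.  Increasing
    degrees are needed for the mapping cones to be minimal. *)
Definition before u v :=
  (mdeg u < mdeg v)%N || ((mdeg u == mdeg v) && (weight u <= weight v)%N).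

Lemma before_total : total before.
Proof. move=> u v; rewrite /before; lia. Qed.

Lemma before_trans : transitive before.
Proof. move=> v u w; rewrite /before; lia. Qed.

(** Were every letter of the earlier generator [y] at least the corresponding
    letter of [x], strong stability would put a prefix of [x] in the ideal; by
    minimality of [x] it is [x] itself, and the weights force [x = y]. *)
Lemma smaller_letter x y : x \in G -> y \in G -> y != x -> before y x ->
  exists2 q, (q < size (word y))%N & (letter (word y) q < letter (word x) q)%N.
Proof.
move=> xG yG nyx yx; have le : (mdeg y <= mdeg x)%N by move: yx; rewrite /before; lia.
pose lt q := (letter (word y) q < letter (word x) q)%N.
case: (boolP (has lt (iota 0 (size (word y))))).
  by case/hasP=> q; rewrite mem_iota => qy yq; exists q.
move=> /hasPn h.
have {}h q : (q < size (word y))%N -> (letter (word x) q <= letter (word y) q)%N.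
  by move=> qy; rewrite leqNgt -/(lt q) h // mem_iota.
have sz : size (take (mdeg y) (word x)) = size (word y).
  by rewrite size_takel size_word.
have xU : mon (take (mdeg y) (word x)) \notin U.
  apply: contra (gen_notin hU hG yG); rewrite -[in y \in U](wordK y).
  apply: (order_ideal_letters hs) => // q; rewrite sz => qy.
  by rewrite letter_take ?h -?size_word.
have xE : mon (take (mdeg y) (word x)) = x.
  by apply: (gen_minimal hG xG xU); rewrite -{2}(wordK x) mon_take_le.
have dE : mdeg y = mdeg x by rewrite -xE mdeg_mon sz size_word.
have [||_ eqw] := @sum_letters _ (word x) (word y); rewrite ?size_word //.
  by move=> q; rewrite -dE -size_word; apply: h.
case/eqP: nyx; rewrite -(wordK x) eqw ?wordK // -!weight_mon !wordK.
by move: yx; rewrite /before dE ltnn eqxx.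
Qed.

(** The first position [q] where an earlier generator [y] has a smaller letter
    than [x] gives a place of [y] that is a colon place of [x].  Conversely a
    colon place comes from lowering one letter of [x], and a prefix of the
    lowered word is a generator that precedes [x]. *)
Lemma stretch_colon x (L1 : seq 'X_{1..m}) : x \in G ->
  (forall y, y \in L1 -> [/\ y \in G, y != x & before y x]) ->
  (forall y, y \in G -> ~~ before x y -> y \in L1) ->
  forall v : 'X_{1..N},
    has (fun y => (set_mon (stretch y) <= v + set_mon (stretch x))%MM) L1 =
    has (fun c => 0 < v c)%N (colon_vars x).
Proof.
move=> xG L1in inL1 v; set e := word x; have se : wsorted e := word_sorted x.
apply/hasP/hasP => [[y /L1in[yG nyx yx]] /set_mon_leP yv|[c]].
  have ex : exists q, (q < size (word y))%N && (letter (word y) q < letter e q)%N.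
    by have [q q1 q2] := smaller_letter xG yG nyx yx; exists q; rewrite q1.
  have [q /andP[qy yq] qmin] := ex_minnP ex; set f := word y in qy yq qmin.
  have qe : (q < size e)%N.
    rewrite ltnNge; apply: contraTN yq => ?.
    by rewrite /letter [nth _ (map val e) _]nth_default ?size_map.
  pose c : 'I_N := Ordinal (place_bound yG qy).
  have cc : val c \in colon_places t e.
    apply/(colon_placesP _ _ se); exists q, (letter f q); split=> // q0.
    apply: leq_trans (letter_mono (word_sorted y) (leq_pred q) qy).
    rewrite leqNgt; apply/negP => lt.
    have := qmin q.-1; rewrite lt (leq_ltn_trans (leq_pred q)) // => /(_ isT).
    by rewrite leqNgt prednK // leqnn.
  exists c; first by rewrite mem_enum inE.
  have := yv c; rewrite inE mnmDE [set_mon _ c]mnmE inE.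
  rewrite (negbTE (colon_places_notin se cc)) addn0.
  by apply; apply/mem_placesP; exists q.
rewrite mem_enum inE => /(colon_placesP _ _ se)[q [k [qe kq qk cE]]] vc.
have km : (k < m)%N := ltn_trans kq (letter_lt qe).
pose f := set_nth (Ordinal km) e q (Ordinal km).
have fl l : letter f l = if l == q then k else letter e l by apply: letter_set.
have sf : size f = size e by rewrite size_set_nth; apply/maxn_idPr.
have fe l : (l < size f)%N -> (letter f l <= letter e l)%N.
  by move=> _; rewrite fl; case: eqP => // ->; apply: ltnW.
have wf : wsorted f.
  apply: wsortedP => l; rewrite sf => le; rewrite !fl.
  have := letter_mono se (leqnSn l) le.
  case: (l =P q) => [->|_]; first by rewrite gtn_eqF // => /(leq_trans (ltnW kq)).
  by case: (l.+1 =P q) => // lq _; have := qk; rewrite -lq => ->.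
have fU : mon f \notin U.
  apply: contra (gen_notin hU hG xG) => fU; rewrite -(wordK x).
  exact: order_ideal_letters hs _ _ sf fe fU.
have [r rG] := gen_prefix hU hs hG wf fU; exists (mon (take r f)).
  apply: inL1 => //; rewrite /before mdeg_mon -size_word -/e.
  have [rs|sr] := ltnP r (size f); first by rewrite size_takel ?(ltnW rs); lia.
  rewrite take_oversize // sf ltnn eqxx /= weight_mon -(wordK x) weight_mon -/e.
  rewrite -ltnNge.
  have [le eqfe] := sum_letters sf fe; rewrite ltn_neqAle le andbT.
  apply/eqP => sumE; have fE := eqfe (eq_leq (esym sumE)).
  by have := fl q; rewrite eqxx fE; move: kq; lia.
apply/set_mon_leP => i; rewrite inE monK ?wsorted_take // => /mem_placesP[l lr iE].
have [lr' lf] : (l < r)%N /\ (l < size f)%N.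
  by move: lr; rewrite size_take_min; lia.
rewrite mnmDE; have [lq|nlq] := eqVneq l q.
  suff -> : i = c by rewrite addn_gt0 vc.
  by apply: val_inj; rewrite /= iE cE place_take // lq /place fl eqxx.
rewrite addn_gt0 [set_mon _ i]mnmE inE iE place_take // /place fl (negbTE nlq).
by rewrite (_ : _ \in _) ?orbT //; apply/mem_placesP; exists l; rewrite -?sf.
Qed.

(** The generators taken by increasing degree, and by increasing weight in each
    degree, have linear quotients. *)
Lemma minimal_betti_squeezed :
  minimal_betti (stanley_reisner K (squeezed_complex U t))
    (fun i j =>
       \sum_(u <- enum_fset G | j == (mdeg u + i)%N%:Z) 'C((max_index u).-1, i))%N.
Proof.
pose L := sort before (enum_fset G).
have pL : perm_eq L (enum_fset G) by rewrite perm_sort.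
have LG : L =i G by exact: perm_mem pL.
have uL : uniq L by rewrite sort_uniq fset_uniq.
have sL : pairwise before L.
  rewrite -sorted_pairwise; last exact: before_trans.
  exact: sort_sorted before_total _.
apply: (minimal_betti_ext (fun p => iff_sym (stanley_reisner_stretch LG p))); last first.
  pose mu u := set_mon (stretch u).
  apply: (@minimal_betti_linear_quotients K N _ L mu colon_vars) => L1 x L2 LE.
  have xG : x \in G by rewrite -LG LE mem_cat mem_head orbT.
  move: (uL) (sL); rewrite LE cat_uniq pairwise_cat /= negb_or.
  move=> /and3P[uL1 /andP[xL1 _] _] /and3P[/allrelP bL1 _ /andP[/allP bL2 _]].
  have L1P y : y \in L1 -> [/\ y \in G, y != x & before y x].
    move=> yL1; split; first by rewrite -LG LE mem_cat yL1.
      by apply: contraNneq xL1 => <-.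
    by apply: bL1; rewrite ?mem_head.
  split=> [|y /L1P[yG _]|]; first exact: enum_uniq.
    by rewrite !mdeg_stretch // /before; lia.
  apply: stretch_colon => // y yG; rewrite -LG LE mem_cat in_cons in yG *.
  case/or3P: yG => [//|/eqP->|/bL2->] //.
  by rewrite /before ltnn eqxx leqnn.
move=> i j /=; rewrite (perm_big _ pL) /= [RHS]big_mkcond big_seq [RHS]big_seq.
apply: eq_bigr => u uG; rewrite mdeg_stretch // size_colon_vars //.
by case: eqP; rewrite ?mul1n.
Qed.

End StretchedIdeal.

Theorem corollary4p3 (K : fieldType) (m : nat) (hm : (1 <= m)%N)
    (U : {fset 'X_{1..m}}) (hU : order_ideal U) (hs : shifted U) (t : nat)
    (G : {fset 'X_{1..m}}) (hG : minimal_monomial_generators (ideal_of K U) G)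
    (i : nat) (j : int) :
  graded_betti_number
    (stanley_reisner K (squeezed_complex U t)) i (i%:Z + j)
    (\sum_(u <- enum_fset G | (mdeg u)%:Z == j) 'C((max_index u).-1, i))%N.
Proof.
have := graded_betti_of_minimal i (i%:Z + j) (minimal_betti_squeezed t hU hs hG).
congr graded_betti_number; apply: eq_bigl => u.
by rewrite PoszD addrC (inj_eq (addIr _)) eq_sym.
Qed.
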